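(* Let $m>1$ and $k\geq 1$ be fixed integers. For a prime $p$ let $q=p^m$. Then there exists a $k$-uniform local arc $\tilde{\mathcal{S}}$ in $\mathrm{PG}(2,q)$ with \[ |\tilde{\mathcal{S}}|=\begin{cases}\Omega(q^{1.1167-0.3833/m}), & m \text{ odd};\\ \Omega(q^{1.1167}), & m=2;\\ \Omega(q^{1.25-0.0166/m}), & 2\mid m,\ 4\nmid m,\ m>2;\\ \Omega(q^{1.25-0.7666/m}), & 4\mid m,\ m>4,\end{cases} \] as $p\to\infty$.
   Context: $\mathrm{PG}(2,q)$ is the classical projective plane of order $q$. An arc is a set of points no three collinear. A $k$-uniform local arc is a collection $\tilde{\mathcal{S}}$ of pairwise disjoint sets of $k$ points such that the union of any two distinct members is an arc; $|\tilde{\mathcal{S}}|$ denotes the number of its members. *)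

(* Defs.v *)
From HB Require Import structures.
From mathcomp Require Import all_boot all_order all_algebra.
From mathcomp Require Import reals exp.

Set Implicit Arguments.
Unset Strict Implicit.
Unset Printing Implicit Defensive.

Import GRing.Theory Num.Theory.

Local Open Scope ring_scope.

HB.instance Definition _ (F : finFieldType) (vT : vectType F) :
  isCountable {vspace vT} :=
  CanIsCountable (@VectorInternalTheory.vs2mxK F vT).
HB.instance Definition _ (F : finFieldType) (vT : vectType F) :
  isFinite {vspace vT} :=
  CanIsFinite (@VectorInternalTheory.vs2mxK F vT).

Section ProjectivePlane.

Variable F : finFieldType.

(* PG(2,q) is the lattice of subspaces of F^3, where q = #|F|: points have
   vector dimension 1, lines have vector dimension 2, incidence is inclusion. *)
Record pg_point := PGPoint {
  pg_point_space :> {vspace 'rV[F]_3};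
  _ : \dim pg_point_space == 1%N
}.

HB.instance Definition _ := [isSub for pg_point_space].
HB.instance Definition _ := [Finite of pg_point by <:].

Record pg_line := PGLine {
  pg_line_space :> {vspace 'rV[F]_3};
  _ : \dim pg_line_space == 2%N
}.

HB.instance Definition _ := [isSub for pg_line_space].
HB.instance Definition _ := [Finite of pg_line by <:].

Definition incident (P : pg_point) (L : pg_line) : bool := (P <= L)%VS.

Definition collinear (P Q R : pg_point) : bool :=
  [exists L : pg_line, [&& incident P L, incident Q L & incident R L]].

Definition arc (A : {set pg_point}) : Prop :=
  forall P Q R : pg_point, P \in A -> Q \in A -> R \in A ->
    P != Q -> P != R -> Q != R -> ~~ collinear P Q R.

Definition uniform_local_arc (k : nat) (S : {set {set pg_point}}) : Prop :=
  [/\ forall B, B \in S -> #|B| = k,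
      forall B C, B \in S -> C \in S -> B != C -> [disjoint B & C]
    & forall B C, B \in S -> C \in S -> B != C -> arc (B :|: C)].

End ProjectivePlane.

(* Given m and k, for p prime and q = p^m there is a k-uniform local arc in
   PG(2,q) with Omega(q^e) members as p -> oo. The implied constant c and the
   threshold p0 may depend on m, k, e only; F ranges over all models of the
   field with q elements. *)
Definition has_uniform_local_arcs_Omega (R : realType) (m k : nat) (e : R)
    : Prop :=
  exists2 c : R, 0 < c &
  exists p0 : nat, forall p : nat, prime p -> (p0 <= p)%N ->
  forall F : finFieldType, #|F| = (p ^ m)%N ->
  exists2 S : {set {set pg_point F}},
    uniform_local_arc k S & c * (p ^ m)%:R `^ e <= #|S|%:R.

(* Main.v *)
Require Import Defs.
From HB Require Import structures.
From mathcomp Require Import all_boot all_order all_algebra.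
From mathcomp Require Import cyclic finfield.
From mathcomp Require Import zify ring lra.
From mathcomp Require Import reals exp.
From Stdlib Require BinNat Nnat.

(** Blocks are [k] points with abscissae [x + i w], [i < k], on the parabola
    [Y = X^2 + a].  The secant through the points [i1, i2] of the block [(x, a)]
    meets the point [i] of the block [(x', a')] iff, with [T = x' - x],
    [(T + (i - i1) w) (T + (i - i2) w) = a - a'], so it suffices to choose the
    pairs [(x, a)] in such a way that these near-squares are never differences
    of the [a]'s.

    Expand [T] in powers of a primitive element [theta].  The lowest nonzero
    coefficient of [T] produces the value of an anisotropic binary quadratic
    form over [F_p] at a fixed position of the product; forcing the [a]'s to
    agree at that position costs a factor [p] and leaves [p^2] values for the
    coefficient.  The last coefficient, which carries the offsets [i w], is
    restricted to a box of integers so small that the remaining equation holds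
    in [Z]; there it is excluded by the base [l] digits of [a], as in Ruzsa's
    construction of sets without square differences, for the form [u^2 + v^2]
    with [l = 3] or, when [m = 2], for the form [u^2] with [l = 205].  With [D]
    anisotropic positions this gives about [p^(m + D + 1/2)] blocks (and
    [p^2.2334] for [m = 2]).

    For odd [m] the positions come from the pairs [theta^(3t)], [theta^(3t+1)].
    For even [m] they are the coefficients over the field with [p^2] elements;
    the products may then exceed the degree of [theta], but the reduced terms
    are [F_p]-multiples of the norm of [theta] up to sign, a nonsquare, and the
    form can be chosen to vanish on these. *)

Set Implicit Arguments.
Unset Strict Implicit.
Unset Printing Implicit Defensive.

Import Order.TTheory GRing.Theory Num.Theory.

Local Open Scope ring_scope.

(** * Blocks on parabolas *)

Section ParabolaBlocks.

Variable F : finFieldType.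
Implicit Types x y a w : F.

Lemma collinearC12 (P Q R : pg_point F) : collinear P Q R = collinear Q P R.
Proof. by apply: eq_existsb => L; rewrite !andbA [X in X && _]andbC. Qed.

Lemma collinearC23 (P Q R : pg_point F) : collinear P Q R = collinear P R Q.
Proof. by apply: eq_existsb => L; congr (_ && _); rewrite andbC. Qed.

Definition affine_vec x y : 'rV[F]_3 := \row_(i < 3) nth 0 [:: 1; x; y] i.

Lemma affine_vec0 x y : affine_vec x y 0 0 = 1.
Proof. by rewrite mxE. Qed.

Lemma affine_vec_neq0 x y : affine_vec x y != 0.
Proof.
apply/eqP => /matrixP /(_ 0 0); rewrite affine_vec0 mxE => /eqP.
by rewrite oner_eq0.
Qed.

Lemma dim_affine_vec x y : \dim <[affine_vec x y]> == 1%N.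
Proof. by rewrite dim_vline affine_vec_neq0. Qed.

Definition affine_point x y : pg_point F := PGPoint (dim_affine_vec x y).

Lemma affine_point_inj x y x' y' :
  affine_point x y = affine_point x' y' -> x = x' /\ y = y'.
Proof.
move/(congr1 val) => /= E.
have /vlineP[c Hc] : affine_vec x y \in <[affine_vec x' y']>%VS.
  by rewrite -E memv_line.
have /matrixP M := Hc.
have c1 : c = 1 by have := M 0 0; rewrite !mxE /= mulr1.
by split; [have := M 0 1 | have := M 0 (inord 2)];
  rewrite !mxE ?inordK //= c1 mul1r.
Qed.

(** A nonzero determinant makes the three representing vectors free, so no line, of vector dimension
    2, contains them all. *)
Lemma not_collinear_affine x1 y1 x2 y2 x3 y3 :
  (x2 - x1) * (y3 - y1) - (x3 - x1) * (y2 - y1) != 0 ->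
  ~~ collinear (affine_point x1 y1) (affine_point x2 y2) (affine_point x3 y3).
Proof.
move=> D0; apply/negP => /existsP[L /and3P[H1 H2 H3]].
have dL : \dim L = 2%N by apply/eqP; case: (L).
pose X := [tuple affine_vec x1 y1; affine_vec x2 y2; affine_vec x3 y3].
have sXL : (<<X>> <= L)%VS.
  apply/span_subvP => v; rewrite !inE => /or3P[]/eqP->;
  rewrite memvE; [exact: H1 | exact: H2 | exact: H3].
have fX : free X.
  apply/freeP => k; rewrite !big_ord_recl big_ord0 addr0.
  set k1 := k ord0; set k2 := k (lift ord0 ord0).
  set k3 := k (lift ord0 (lift ord0 ord0)) => /matrixP E.
  have E0 := E 0 0; have E1 := E 0 1; have E2 := E 0 (inord 2).
  rewrite !mxE /= in E0; rewrite !mxE /= in E1.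
  rewrite !mxE !inordK //= in E2.
  (* Eliminating [k1] leaves a 2 by 2 system in [k2] and [k3] with the given determinant, solved by
     Cramer's rule. *)
  have F1 : k2 * (x2 - x1) + k3 * (x3 - x1) = 0.
    transitivity (k1 * x1 + (k2 * x2 + k3 * x3)
      - (k1 * 1 + (k2 * 1 + k3 * 1)) * x1); first by ring.
    by rewrite E1 E0 mul0r subrr.
  have F2 : k2 * (y2 - y1) + k3 * (y3 - y1) = 0.
    transitivity (k1 * y1 + (k2 * y2 + k3 * y3)
      - (k1 * 1 + (k2 * 1 + k3 * 1)) * y1); first by ring.
    by rewrite E2 E0 mul0r subrr.
  have k20 : k2 = 0.
    apply/eqP; rewrite -(mulIr_eq0 k2 (mulIf D0)); apply/eqP.
    transitivity ((k2 * (x2 - x1) + k3 * (x3 - x1)) * (y3 - y1) -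
      (k2 * (y2 - y1) + k3 * (y3 - y1)) * (x3 - x1)); first by ring.
    by rewrite F1 F2 !mul0r subrr.
  have k30 : k3 = 0.
    apply/eqP; rewrite -(mulIr_eq0 k3 (mulIf D0)); apply/eqP.
    transitivity ((k2 * (y2 - y1) + k3 * (y3 - y1)) * (x2 - x1) -
      (k2 * (x2 - x1) + k3 * (x3 - x1)) * (y2 - y1)); first by ring.
    by rewrite F1 F2 !mul0r subrr.
  have k10 : k1 = 0 by move: E0; rewrite k20 k30 !mul0r !addr0 mulr1.
  case=> [[|[|[|//]]] Hi].
  - by rewrite -[RHS]k10; congr (k _); apply: val_inj.
  - by rewrite -[RHS]k20; congr (k _); apply: val_inj.
  - by rewrite -[RHS]k30; congr (k _); apply: val_inj.
have := dimvS sXL; rewrite dL.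
by move: fX; rewrite /free => /eqP ->.
Qed.

Definition parabola_point x a := affine_point x (x ^+ 2 + a).

(** With two of the points on the same parabola the determinant factors as [(x2 - x1) * ((x3 - x1) *
    (x3 - x2) - (a - a3))]. *)
Lemma not_collinear_parabola x1 x2 a x3 a3 :
  x1 != x2 -> (x3 - x1) * (x3 - x2) != a - a3 ->
  ~~ collinear (parabola_point x1 a) (parabola_point x2 a)
               (parabola_point x3 a3).
Proof.
move=> x12 H; apply: not_collinear_affine.
rewrite (_ : _ - _ = (x2 - x1) * ((x3 - x1) * (x3 - x2) - (a - a3)));
  last by ring.
by rewrite mulf_neq0 // subr_eq0 // eq_sym.
Qed.

Variables (k : nat) (w : F).

Definition parabola_block x a : {set pg_point F} :=
  [set parabola_point (x + w *+ i) a | i : 'I_k].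

Hypothesis w_inj : forall i j : 'I_k, w *+ i = w *+ j -> i = j.

Lemma card_parabola_block x a : #|parabola_block x a| = k.
Proof.
rewrite card_imset ?card_ord // => i j /affine_point_inj[/addrI E _].
exact: w_inj.
Qed.

Variables (I : finType) (x a : I -> F).

Hypothesis separated : forall s t : I, s != t -> forall i i1 i2 : 'I_k,
  (x t + w *+ i - (x s + w *+ i1)) * (x t + w *+ i - (x s + w *+ i2))
    != a s - a t.

Definition block (s : I) := parabola_block (x s) (a s).

(** A common point would make both sides of [separated] vanish for a choice with [i1 = i2]. *)
Lemma disjoint_blocks s t : s != t -> [disjoint block s & block t].
Proof.
move=> st; apply/pred0P => P /=; apply/negP => /andP[/imsetP[i _ ->]].
move=> /imsetP[j _ /affine_point_inj[E1 E2]].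
have Ea : a s = a t by move: E2; rewrite E1 => /addrI.
by have := separated st j i i; rewrite E1 Ea !subrr mul0r eqxx.
Qed.

(** Three points of one block lie on one parabola. Otherwise two points lie in one block and the
    third in the other, which [separated] handles after a permutation. *)
Lemma arc_blocks s t : s != t -> Defs.arc (block s :|: block t).
Proof.
have same (u : I) P Q R : P \in block u -> Q \in block u -> R \in block u ->
    P != Q -> P != R -> Q != R -> ~~ collinear P Q R.
  move=> /imsetP[i _ ->] /imsetP[j _ ->] /imsetP[l _ ->] PQ PR QR.
  apply: not_collinear_parabola.
    by apply: contraNneq PQ => ->.
  rewrite subrr mulf_neq0 // subr_eq0; [move: PR|move: QR];
    by apply: contraNneq => ->.
have diff u v P Q R : u != v -> P \in block u -> Q \in block u ->
    R \in block v -> P != Q -> ~~ collinear P Q R.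
  move=> uv /imsetP[i _ ->] /imsetP[j _ ->] /imsetP[l _ ->] PQ.
  apply: not_collinear_parabola; last exact: separated.
  by apply: contraNneq PQ => ->.
move=> st P Q R; have ts : t != s by rewrite eq_sym.
rewrite !in_setU => /orP[]HP /orP[]HQ /orP[]HR PQ PR QR.
- exact: same HP HQ HR PQ PR QR.
- exact: diff st HP HQ HR PQ.
- rewrite collinearC23; exact: diff st HP HR HQ PR.
- rewrite collinearC12 collinearC23; exact: diff ts HQ HR HP QR.
- rewrite collinearC12 collinearC23; exact: diff st HQ HR HP QR.
- rewrite collinearC23; exact: diff ts HP HR HQ PR.
- exact: diff ts HP HQ HR PQ.
- exact: same HP HQ HR PQ PR QR.
Qed.

Lemma parabola_local_arc : (0 < k)%N ->
  exists2 S : {set {set pg_point F}}, uniform_local_arc k S & #|S| = #|I|.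
Proof.
move=> k0; exists (block @: I).
  split=> [B /imsetP[s _ ->]|B C /imsetP[s _ ->] /imsetP[t _ ->] st|
           B C /imsetP[s _ ->] /imsetP[t _ ->] st].
  - exact: card_parabola_block.
  - by apply: disjoint_blocks; apply: contraNneq st => ->.
  - by apply: arc_blocks; apply: contraNneq st => ->.
(* Equal blocks at distinct indices would be disjoint from themselves, hence empty, against
   [0 < k]. *)
rewrite card_imset // => s t E; apply: contraTeq (k0) => /disjoint_blocks.
rewrite E -setI_eq0 setIid => /eqP E0.
by rewrite -(card_parabola_block (x t) (a t)) [parabola_block _ _]E0 cards0.
Qed.

End ParabolaBlocks.

(** * Digit sets *)

(** Taking [r = r'] shows that [u^2 + e v^2] is anisotropic modulo [l]; for distinct residues the
    difference is not a value of the form. For [e = 0] the variable [v] is frozen at 0, leaving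
    squares. *)
Definition residue_set (l : nat) (R : seq nat) (e : int) : Prop :=
  [/\ uniq R, all (ltn^~ l) R &
   forall r r' : nat, r \in R -> r' \in R ->
   forall u v : int, (e = 0 -> v = 0) ->
   (l %| u ^+ 2 + e * v ^+ 2 - (r%:Z - r'%:Z))%Z ->
   [/\ (l %| u)%Z, (l %| v)%Z & r = r']].

Section Digits.

Variables (l : nat) (R : seq nat) (e : int).

(** Numbers with [2 * H] digits in base [l]: digits from [R] at even positions, free digits at odd
    ones. The free positions are harmless because anisotropy makes the lowest nonzero digit of a
    value of the form sit at an even position. *)
Fixpoint digit_set (H : nat) : seq nat :=
  if H is H'.+1 then
    [seq (rf.1 + l * (rf.2 + l * b))%N |
      rf <- [seq (r, f) | r <- R, f <- iota 0 l], b <- digit_set H']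
  else [:: 0%N].

Hypothesis l_gt0 : (0 < l)%N.
Hypothesis HR : residue_set l R e.

Lemma size_digit_set H : size (digit_set H) = ((size R * l) ^ H)%N.
Proof. by elim: H => //= H IH; rewrite !size_allpairs size_iota IH expnS. Qed.

Lemma digit_setS H b : b \in digit_set H.+1 ->
  exists r f c, [/\ r \in R, (f < l)%N, c \in digit_set H &
                    b = (r + l * (f + l * c))%N].
Proof.
move=> /allpairsP[[[r f] c] /= [/allpairsP[[r' f'] /= [rR fl [-> ->]]] cB ->]].
by exists r', f', c; split=> //; move: fl; rewrite mem_iota.
Qed.

Lemma digit_set_lt H b : b \in digit_set H -> (b < l ^ (2 * H))%N.
Proof.
elim: H b => [|H IH] b; first by rewrite inE => /eqP->.
move=> /digit_setS[r [f [c [rR fl /IH cl ->]]]].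
have rl : (r < l)%N by case: HR => _ /allP /(_ r rR).
by rewrite mulnS expnD; move: (l ^ (2 * H))%N cl => L cl; nia.
Qed.

Lemma uniq_digit_set H : uniq (digit_set H).
Proof.
have [uR lR _] := HR.
elim: H => //= H IH; apply: allpairs_uniq => //.
  by apply: allpairs_uniq => //; [exact: iota_uniq | move=> [? ?] [? ?]].
move=> [[r f] b] [[r' f'] b'] /allpairsP[[[r1 f1] b1] /= [+ _ [-> -> ->]]].
move=> /allpairsP[[r2 f2] /= [+ + [-> ->]]].
move=> /(allP lR) /= r1l; rewrite mem_iota /= => f1l.
move=> /allpairsP[[[r3 f3] b3] /= [+ _ [-> -> ->]]].
move=> /allpairsP[[r4 f4] /= [+ + [-> ->]]].
move=> /(allP lR) /= r3l; rewrite mem_iota /= => f3l E.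
have E1 := congr1 (modn^~ l) E; move: E1.
rewrite ![(_ + l * _)%N]addnC ![(l * _)%N]mulnC !modnMDl !modn_small // => Er.
rewrite Er in E *; move: E => /addnI /eqP; rewrite eqn_pmul2l // => /eqP E.
have E1 := congr1 (modn^~ l) E; move: E1.
rewrite ![(_ + l * _)%N]addnC ![(l * _)%N]mulnC !modnMDl !modn_small // => Ef.
rewrite Ef in E *; move: E => /addnI /eqP; rewrite eqn_pmul2l // => /eqP E.
by rewrite E.
Qed.

(** Descent on [H]. Modulo [l] only the form and the lowest digits survive, so [l] divides [u] and
    [v] and these digits agree; after division by [l ^ 2] the offset terms in [j] and [i] reappear
    with [l ^ H] one power lower. *)
Lemma digit_set_separated H (b b' : nat) (u v j i : int) :
  b \in digit_set H -> b' \in digit_set H ->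
  `|u| < (l ^ H)%:Z -> `|v| < (l ^ H)%:Z -> (e = 0 -> v = 0) ->
  u ^+ 2 + e * v ^+ 2 + j * (l ^ H)%:Z * u + (l ^ H)%:Z ^+ 2 * i
    = b%:Z - b'%:Z ->
  [/\ u = 0, v = 0 & b = b'].
Proof.
elim: H b b' u v => [|H IH] b b' u v.
  rewrite !inE expn0 => /eqP -> /eqP -> u1 v1 _ _.
  by split=> //; lia.
move=> /digit_setS[r [f [c [rR fl cB ->]]]].
move=> /digit_setS[r' [f' [c' [r'R f'l c'B ->]]]] ul vl ev.
have lZ : l%:Z != 0 by lia.
rewrite expnS PoszM in ul vl *; set N := (l ^ H)%:Z in ul vl * => E.
have [_ _ /(_ r r' rR r'R u v ev)] := HR; case.
  apply/dvdzP; exists ((f%:Z + l%:Z * c%:Z) - (f'%:Z + l%:Z * c'%:Z)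
    - j * N * u - N ^+ 2 * l%:Z * i).
  move: E => /eqP; rewrite !PoszD !PoszM !PoszD !PoszM.
  rewrite -subr_eq0 => /eqP E; apply/eqP; rewrite -subr_eq0 -E.
  by apply/eqP; ring.
move=> /dvdzP[u1 Eu] /dvdzP[v1 Ev] Er.
move: E ul vl ev; rewrite {}Eu {}Ev {}Er => E ul vl ev.
have {}E : (f%:Z - f'%:Z) = l%:Z * (u1 ^+ 2 + e * v1 ^+ 2 + j * N * u1
     + N ^+ 2 * i - (c%:Z - c'%:Z)).
  apply: (mulfI lZ); move: E => /eqP; rewrite !PoszD !PoszM !PoszD !PoszM.
  rewrite -subr_eq0 => /eqP E; apply/eqP; rewrite -subr_eq0 -oppr_eq0 -E.
  by apply/eqP; ring.
(* Two digits below [l] whose difference is divisible by [l] are equal. *)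
have Ef : f = f'.
  move: E; set z := (X in l%:Z * X) => E.
  have z0 : z = 0 by nia.
  by move: E; rewrite z0 mulr0; lia.
rewrite {}Ef subrr in E *.
have {}E : u1 ^+ 2 + e * v1 ^+ 2 + j * N * u1 + N ^+ 2 * i = c%:Z - c'%:Z.
  apply/eqP; rewrite -subr_eq0; apply/eqP; apply: (mulfI lZ).
  by rewrite mulr0 -E.
have ev1 : e = 0 -> v1 = 0.
  by move=> /ev /eqP; rewrite mulf_eq0 (negPf lZ) orbF => /eqP.
have [||-> -> ->] := IH c c' u1 v1 cB c'B _ _ ev1 E.
- by move: ul; rewrite normrM /= mulrC ltr_pM2l //; lia.
- by move: vl; rewrite normrM /= mulrC ltr_pM2l //; lia.
by rewrite !mul0r.
Qed.

End Digits.

(** Squares modulo 3 are 0 and 1, so a sum of two squares is divisible by 3 only if both terms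
    are. *)
Lemma residue_set3 : residue_set 3 [:: 0%N] 1.
Proof.
split=> // r r'; rewrite !inE => /eqP -> /eqP -> u v _.
rewrite subr0 mul1r => /dvdzP[q E].
have Hu := divz_eq u 3; have Hv := divz_eq v 3.
have u3 : 0 <= (u %% 3)%Z < 3 by rewrite modz_ge0 //= ltz_pmod.
have v3 : 0 <= (v %% 3)%Z < 3 by rewrite modz_ge0 //= ltz_pmod.
suff: (u %% 3)%Z = 0 /\ (v %% 3)%Z = 0.
  by case=> u0 v0; split=> //; apply/dvdz_mod0P.
rewrite {}Hu {}Hv in E.
move: (u %% 3)%Z (v %% 3)%Z (u %/ 3)%Z (v %/ 3)%Z u3 v3 E => a b c d a3 b3 E.
have: (a = 0 \/ a = 1 \/ a = 2) by lia.
have: (b = 0 \/ b = 1 \/ b = 2) by lia.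
by move=> [|[]] eb [|[]] ea; move: E; rewrite ea eb => E; split=> //; lia.
Qed.

(* Found by computer search; the size is that of Lewko's improvement of
   Ruzsa's construction modulo 65. *)
Definition lewko_set : seq nat :=
  [:: 0; 12; 26; 55; 69; 88; 99; 123; 142; 161; 175; 198]%N.

(** The congruence is stated additively, as [s + r' = r] modulo 205, because subtraction on [nat]
    truncates. *)
Lemma lewko_check :
  all (fun u => let s := (u ^ 2 %% 205)%N in
    all (fun r => all (fun r' => ((s + r') %% 205 == r) ==>
      ((u == 0) && (r == r')))%N lewko_set) lewko_set) (iota 0 205).
Proof. by vm_compute. Qed.

Lemma residue_set205 : residue_set 205 lewko_set 0.
Proof.
split=> // r r' rR r'R u v /(_ erefl) -> E.
have r205 : (r < 205)%N by have /allP /(_ r rR) : all (ltn^~ 205%N) lewko_set.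
have Hu := divz_eq u 205.
have u205 : 0 <= (u %% 205)%Z < 205 by rewrite modz_ge0 //= ltz_pmod.
have [s sE] : exists s : nat, (u %% 205)%Z = s by exists `|(u %% 205)%Z|%N; lia.
have sI : s \in iota 0 205 by rewrite mem_iota; lia.
have /allP /(_ s sI) /allP /(_ r rR) /allP /(_ r' r'R) := lewko_check.
have -> : ((s ^ 2 %% 205 + r') %% 205 == r)%N.
  rewrite modnDml -[X in _ == X](modn_small r205).
  rewrite -eqz_nat -!modz_nat.
  rewrite eqz_mod_dvd.
  move: E => /dvdzP[q E]; apply/dvdzP.
  (* This quotient comes from expanding the square of [u = 205 * (u %/ 205) + s]. *)
  exists (q - 205 * (u %/ 205)%Z ^+ 2 - 2 * s%:Z * (u %/ 205)%Z).
  rewrite PoszD -mulnn PoszM.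
  move: E => /eqP; rewrite {1}Hu sE !mul0r addr0 -subr_eq0 => /eqP E.
  by apply/eqP; rewrite -subr_eq0 -E; apply/eqP; ring.
move=> /= /andP[/eqP s0 /eqP ->]; split=> //.
by apply/dvdz_mod0P; rewrite sE s0.
Qed.

(** * The general construction *)

(** Pigeonhole: [B] is a most populated fibre. *)
Lemma large_fibre (T U : finType) (A : {set T}) (f : T -> U) (c : nat) :
  (#|f @: A| <= c)%N ->
  exists2 B : {set T}, B \subset A /\ {in B &, forall x y, f x = f y} &
    (#|A| <= c * #|B|)%N.
Proof.
move=> fc; have [->|[a0 a0A]] := set_0Vmem A.
  by exists set0; [split=> [|x]; rewrite ?sub0set ?inE | rewrite cards0].
pose B y := [set x in A | f x == y].
pose y0 := [arg max_(y > f a0 in f @: A) #|B y|].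
have hy0 y : y \in f @: A -> (#|B y| <= #|B y0|)%N.
  by rewrite /y0; case: arg_maxnP => [|z zA Hz /Hz //]; exact: imset_f.
exists (B y0).
  split; first by apply/subsetP => x; rewrite inE => /andP[].
  by move=> x y; rewrite !inE => /andP[_ /eqP->] /andP[_ /eqP->].
rewrite -sum1_card (partition_big_imset f) /=.
apply: leq_trans (_ : \sum_(y in f @: A) #|B y0| <= _)%N.
  apply: leq_sum => y yA; apply: leq_trans (hy0 y yA).
  by rewrite -sum1_card; apply/eq_leq/eq_bigl => x; rewrite inE.
by rewrite sum_nat_const leq_mul2r fc orbT.
Qed.

(** Fibres are taken successively for [f 0, ..., f (D - 1)], each at the cost of a factor [c]. *)
Lemma large_common_fibre (T U : finType) (c D : nat) (f : nat -> T -> U) :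
  (forall t, (#|f t @: T| <= c)%N) ->
  exists2 B : {set T}, forall t, (t < D)%N -> {in B &, forall x y, f t x = f t y} &
    (#|T| <= c ^ D * #|B|)%N.
Proof.
move=> fc; elim: D => [|D [A HA cA]].
  by exists setT => //; rewrite expn0 mul1n cardsT.
have [|B [BA HB] cB] := @large_fibre _ _ A (f D) c.
  by apply: leq_trans (fc D); apply: subset_leq_card; apply: imsetS; apply/subsetP.
exists B.
  move=> t; rewrite ltnS leq_eqVlt => /orP[/eqP-> //|tD] x y xB yB.
  by apply: (HA t tD); apply: (subsetP BA).
by rewrite expnSr -mulnA; apply: leq_trans cA _; rewrite leq_mul2l cB orbT.
Qed.

Lemma normz_sub_lt (a b n : nat) :
  (a < n)%N -> (b < n)%N -> `|a%:Z - b%:Z| < n%:Z.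
Proof. by lia. Qed.

(** This bound allows a congruence modulo [p] to be read as an equation of integers. *)
Lemma secant_bound (N k p : nat) (e du dv : int) (b b' i i1 i2 : nat) :
  let j : int := i%:Z - i1%:Z + (i%:Z - i2%:Z) in
  let i0 : int := (i%:Z - i1%:Z) * (i%:Z - i2%:Z) in
  0 <= e <= 1 -> `|du| < N%:Z -> `|dv| < N%:Z ->
  (b < N * N)%N -> (b' < N * N)%N -> (i < k)%N -> (i1 < k)%N -> (i2 < k)%N ->
  ((k + 2) ^ 2 * N ^ 2 <= p)%N ->
  `|du ^+ 2 + e * dv ^+ 2 + j * N%:Z * du
      + (i0 * N%:Z ^+ 2 - (b%:Z - b'%:Z))| < p%:Z.
Proof.
move=> j i0 e01 duN dvN bN b'N ik i1k i2k kp.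
have d1 := normz_sub_lt ik i1k; have d2 := normz_sub_lt ik i2k.
have Npos : 0 < N%:Z by apply: le_lt_trans duN.
have dbN : `|b%:Z - b'%:Z| <= N%:Z ^+ 2.
  by apply/ltW; rewrite expr2 -PoszM; exact: normz_sub_lt.
have jk : `|j| <= 2 * k%:Z.
  apply: le_trans (ler_normD _ _) _; rewrite mulr_natl mulr2n.
  by apply: lerD; exact: ltW.
have i0k : `|i0| <= k%:Z ^+ 2.
  by rewrite /i0 normrM expr2; apply: ler_pM => //; exact: ltW.
have B1 : `|du ^+ 2| <= N%:Z ^+ 2 by rewrite normrX lerXn2r ?nnegrE // ltW.
have B2 : `|e * dv ^+ 2| <= N%:Z ^+ 2.
  rewrite normrM normrX -[X in _ <= X]mul1r.
  case/andP: e01 => e0 e1; rewrite (ger0_norm e0).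
  apply: ler_pM => //.
  by rewrite lerXn2r ?nnegrE // ltW.
have B3 : `|j * N%:Z * du| <= 2 * k%:Z * N%:Z ^+ 2.
  rewrite !normrM expr2 mulrA; apply: ler_pM => //; last exact: ltW.
  by rewrite (ger0_norm (ltW Npos)) ler_wpM2r // ltW.
have B4 : `|i0 * N%:Z ^+ 2| <= k%:Z ^+ 2 * N%:Z ^+ 2.
  by rewrite normrM [X in _ * X]ger0_norm ?exprn_ge0 // ler_wpM2r // exprn_ge0.
apply: le_lt_trans (ler_normD _ _) _.
apply: le_lt_trans (lerD (ler_normD _ _) (ler_normB _ _)) _.
apply: le_lt_trans (lerD (lerD (ler_normD _ _) (lexx _)) (lexx _)) _.
apply: le_lt_trans (lerD (lerD (lerD B1 B2) B3) (lerD B4 dbN)) _.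
apply: (@lt_le_trans _ _ ((k%:Z + 2) ^+ 2 * N%:Z ^+ 2)); last first.
  by move: kp; rewrite -!mulnn -lez_nat !PoszM PoszD !expr2.
have : 0 < N%:Z ^+ 2 by rewrite exprn_gt0.
have : 0 <= k%:Z by [].
move: (N%:Z ^+ 2) (k%:Z) => Q K K0 Q0.
(* The five bounds add up to [(K^2 + 2K + 3) Q], which is smaller than [(K + 2)^2 Q] by
   [(2K + 1) Q]. *)
have -> : (K + 2) ^+ 2 * Q = Q + Q + 2 * K * Q + (K ^+ 2 * Q + Q) + (2 * K + 1) * Q.
  by ring.
by rewrite ltrDl mulr_gt0 // ltr_wpDl // mulr_ge0.
Qed.

(** * Abscissae as towers in powers of [theta ^+ s] *)

Section Tower.

Variables (F : finFieldType) (p m : nat).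
Hypotheses (pF : p \in [pchar F]) (cardF : #|F| = (p ^ m)%N).

Variables (theta : F) (s : nat) (M : {set F}) (g h : {additive F -> F}).
Variables (beta : F) (e : int) (D : nat).
Hypothesis theta_neq0 : theta != 0.
Hypothesis M_sub : {in M &, forall a b, a - b \in M}.

(** Horner form of the sum of [a_t theta^(s t)] over the entries of [ms], plus [theta^(s n) y] where
    [n] is their number. *)
Definition tower (ms : seq F) (y : F) : F :=
  foldr (fun a z => a + theta ^+ s * z) y ms.

(** The shape of a difference of two abscissae. The integers [u] and [v] are unbounded here, so that
    differences keep this shape. *)
Definition level (n : nat) (y : F) : Prop :=
  exists (ms : seq F) (u v : int), [/\ size ms = n, {subset ms <= M} &
    y = tower ms (u%:~R + v%:~R * beta)].

(* [(y + b1 w) (y + b2 w)] with [w] an integer multiple of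
   [theta ^+ (s * n)]. *)
Definition secant_form (n : nat) (y : F) (j i : int) : F :=
  y ^+ 2 + j%:~R * y * theta ^+ (s * n) + i%:~R * theta ^+ (2 * (s * n)).

(** In the applications [g] turns this secant form into an anisotropic quadratic form over [F_p] in
    [a] alone, whatever [y] and the offsets are. *)
Hypothesis leading : forall n a y j i, (n < D)%N -> a \in M -> level n y ->
  g (secant_form n.+1 (a + theta ^+ s * y) j i) = 0 -> a = 0.

Lemma towerB ms ms' u v u' v' : size ms = size ms' ->
  {subset ms <= M} -> {subset ms' <= M} ->
  level (size ms) (tower ms (u%:~R + v%:~R * beta)
                   - tower ms' (u'%:~R + v'%:~R * beta)).
Proof.
elim: ms ms' => [|a ms IH] [|a' ms'] //=.
  move=> _ _ _; exists [::], (u - u'), (v - v'); split=> //=.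
  by rewrite !rmorphB /=; ring.
move=> [E] sM sM'; have [||ns [u1 [v1 [sz ns1 E1]]]] := IH ms' E.
- by move=> x xs; apply: sM; rewrite inE xs orbT.
- by move=> x xs; apply: sM'; rewrite inE xs orbT.
exists (a - a' :: ns), u1, v1; split=> /=; first by rewrite sz.
  move=> x; rewrite inE => /orP[/eqP->|]; last exact: ns1.
  by apply: M_sub; [apply: sM | apply: sM']; rewrite inE eqxx.
by rewrite -E1; ring.
Qed.

(* When the leading coefficient vanishes, the problem repeats one level down. *)
Lemma secant_form_shift n y j i :
  secant_form n.+1 (theta ^+ s * y) j i
    = theta ^+ (2 * s) * secant_form n y j i.
Proof.
by rewrite /secant_form mulnS !mul2n -!addnn !exprD; ring.
Qed.

(** Induction on the height: the condition at [t = 0] makes the leading coefficients agree, and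
    factoring out [theta ^+ (2 * s)] turns condition [t + 1] into condition [t] for the shorter
    towers. *)
Lemma tower_inj ms ms' u v u' v' j i : size ms = size ms' ->
  (size ms <= D)%N -> {subset ms <= M} -> {subset ms' <= M} ->
  (forall t, (t < size ms)%N -> g (theta ^- (2 * s * t) *
    secant_form (size ms) (tower ms (u%:~R + v%:~R * beta)
      - tower ms' (u'%:~R + v'%:~R * beta)) j i) = 0) ->
  ms = ms'.
Proof.
elim: ms ms' => [|a ms IH] [|a' ms'] //= [E] szD sM sM' G.
have sMs : {subset ms <= M} by move=> x xs; apply: sM; rewrite inE xs orbT.
have sMs' : {subset ms' <= M} by move=> x xs; apply: sM'; rewrite inE xs orbT.
have aa : a = a'.
  apply/eqP; rewrite -subr_eq0; apply/eqP.
  apply: (@leading (size ms) _ (tower ms (u%:~R + v%:~R * beta)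
    - tower ms' (u'%:~R + v'%:~R * beta)) j i) => //.
  - by apply: M_sub; [apply: sM | apply: sM']; rewrite inE eqxx.
  - exact: towerB.
  have := G 0%N isT; rewrite muln0 expr0 invr1 mul1r => <-.
  by congr (g (secant_form _ _ _ _)); ring.
congr (_ :: _) => //; apply: IH => //; first exact: ltnW.
move=> t tm; have := G t.+1 tm.
rewrite aa opprD addrACA subrr add0r -mulrBr secant_form_shift mulnS exprD mulrA => <-.
congr (g (_ * _)); rewrite invfM mulrAC mulVf ?mul1r //.
by rewrite expf_neq0.
Qed.

Lemma towerBr ms y z : tower ms y - tower ms z = theta ^+ (s * size ms) * (y - z).
Proof.
elim: ms => [|a ms IH] /=; first by rewrite muln0 expr0 mul1r.
by rewrite opprD addrACA subrr add0r -mulrBr IH mulnS exprD mulrA.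
Qed.

Lemma secant_form_top y j i : secant_form D (theta ^+ (s * D) * y) j i =
  theta ^+ (2 * (s * D)) * (y ^+ 2 + j%:~R * y + i%:~R).
Proof. by rewrite /secant_form mul2n -addnn exprD; ring. Qed.

Hypotheses (h1 : h 1 = 1) (hbeta : h beta = 0) (hbeta2 : h (beta ^+ 2) = e%:~R).

(** All coefficients on [1], [beta], [beta ^+ 2] are integers, so additivity of [h] is enough to
    pull them out. *)
Lemma h_form (u v j i : int) :
  let y := u%:~R + v%:~R * beta in
  h (y ^+ 2 + j%:~R * y + i%:~R) = (u ^+ 2 + e * v ^+ 2 + j * u + i)%:~R.
Proof.
have hZ (n : int) z : h (n%:~R * z) = n%:~R * h z.
  by rewrite mulrzl raddfMz mulrzl.
move=> y; have -> : y ^+ 2 + j%:~R * y + i%:~R =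
    (u ^+ 2 + j * u + i)%:~R * 1 + (2 * u * v + j * v)%:~R * beta
    + (v ^+ 2)%:~R * beta ^+ 2.
  by rewrite /y !(rmorphD, rmorphM, rmorphXn) /=; ring.
rewrite ![h (_ + _)]raddfD !hZ h1 hbeta hbeta2.
by rewrite !(rmorphD, rmorphM, rmorphXn) /=; ring.
Qed.

Lemma intr_eq0_small (z : int) : `|z| < p%:Z -> z%:~R = 0 :> F -> z = 0.
Proof.
move=> zp /eqP; rewrite -(dvdz_pcharf pF) => /dvdzP[q E].
by have q0 : q = 0; [nia | rewrite E q0 mul0r].
Qed.

Variables (l : nat) (R : seq nat) (H k V : nat).
Hypotheses (l_gt0 : (0 < l)%N) (HR : residue_set l R e).
(** [V] is the number of values of the coordinate [v]; for [e = 0] the form does not see [v], which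
    then takes the single value 0. *)
Hypotheses (VN : (V <= l ^ H)%N) (eV : e = 0 -> V = 1%N).
Hypothesis e01 : 0 <= e <= 1.
Hypotheses (k_gt0 : (0 < k)%N) (kp : ((k + 2) ^ 2 * (l ^ H) ^ 2 <= p)%N).
Hypotheses (gp : (#|g @: F| <= p)%N) (hp : (#|h @: F| <= p)%N).
Hypothesis cardM : #|M| = (p ^ 2)%N.

Local Notation N := (l ^ H)%N.
Local Notation B := (digit_set l R H).

Section Index.

Variable K : {set F}.
Hypothesis Kg : forall t, (t < D)%N ->
  {in K &, forall x y, g (theta ^- (2 * s * t) * x) = g (theta ^- (2 * s * t) * y)}.
Hypothesis Kh : {in K &, forall x y,
  h (theta ^- (2 * (s * D)) * x) = h (theta ^- (2 * (s * D)) * y)}.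

(** One block for each choice of the tower coefficients, the box coordinates [u < N] and [v < V], a
    constant from the common fibre [K], and a member of the digit set, given by its position. *)
Definition arc_index : finType :=
  (D.-tuple {x : F | x \in M} * 'I_N * 'I_V * {x : F | x \in K} *
   'I_(size B))%type.

Definition arc_x (z : arc_index) : F := let: (ms, u, v, _, _) := z in
  tower (map val ms) ((u : nat)%:~R + (v : nat)%:~R * beta).

Definition arc_a (z : arc_index) : F := let: (_, _, _, c, b) := z in
  val c + (nth 0%N B b)%:~R * theta ^+ (2 * (s * D)).

Lemma card_arc_index :
  #|arc_index| = ((p ^ 2) ^ D * N * V * #|K| * (size R * l) ^ H)%N.
Proof.
by rewrite !card_prod card_tuple !card_sig !card_ord size_digit_set cardM.
Qed.

(** The coordinates are recovered in order: the tower coefficients from [g], then [u], [v] and the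
    digits from [h] and the descent in [digit_set_separated], and finally the constant [c]. *)
Lemma arc_separated (z t : arc_index) (i i1 i2 : 'I_k) :
  let w := N%:R * theta ^+ (s * D) in
  (arc_x t + w *+ i - (arc_x z + w *+ i1)) *
  (arc_x t + w *+ i - (arc_x z + w *+ i2)) = arc_a z - arc_a t ->
  z = t.
Proof.
move: z t => [[[[ms u] v] [c cK]] b] [[[[ms' u'] v'] [c' c'K]] b'] w /=.
set y := (u : nat)%:~R + _; set y' := (u' : nat)%:~R + _.
pose T := tower (map val ms') y' - tower (map val ms) y; move=> E.
pose j : int := (i : nat)%:Z - (i1 : nat)%:Z + ((i : nat)%:Z - (i2 : nat)%:Z).
pose i0 : int := ((i : nat)%:Z - (i1 : nat)%:Z) * ((i : nat)%:Z - (i2 : nat)%:Z).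
pose db : int := (nth 0%N B b)%:Z - (nth 0%N B b')%:Z.
(* The digit difference sits at [theta ^+ (2 * (s * D))], so it is absorbed into the constant term
   of the secant form. *)
have EE : secant_form D T (j * N%:Z) (i0 * N%:Z ^+ 2 - db) = c - c'.
  have -> : c - c' = c + (nth 0%N B b)%:~R * theta ^+ (2 * (s * D))
      - (c' + (nth 0%N B b')%:~R * theta ^+ (2 * (s * D)))
      - db%:~R * theta ^+ (2 * (s * D)).
    by rewrite rmorphB /=; ring.
  rewrite -E /secant_form mul2n -addnn exprD -![w *+ _]mulr_natr /w /T /j /i0.
  by rewrite !(rmorphD, rmorphN, rmorphM, rmorphXn) /= -!pmulrn; ring.
have szm (q : D.-tuple {x : F | x \in M}) : size (map val q) = D.
  by rewrite size_map size_tuple.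
have subm (q : D.-tuple {x : F | x \in M}) : {subset map val q <= M}.
  by move=> x /mapP[[x' x'M] _ ->].
have Ems : map val ms' = map val ms.
  apply: (tower_inj (u := (u' : nat)) (v := (v' : nat)) (u' := (u : nat))
   (v' := (v : nat)) (j := j * N%:Z) (i := i0 * N%:Z ^+ 2 - db));
    rewrite ?szm //; try exact: subm.
  by move=> n nD; rewrite -/y -/y' -/T EE mulrBr raddfB (Kg nD cK c'K) subrr.
have ET : T = theta ^+ (s * D) * (y' - y) by rewrite /T Ems towerBr szm.
pose du : int := (u' : nat)%:Z - (u : nat)%:Z.
pose dv : int := (v' : nat)%:Z - (v : nat)%:Z.
have Ey : y' - y = du%:~R + dv%:~R * beta.
  by rewrite /y /y' /du /dv !rmorphB /=; ring.
have bB : nth 0%N B b \in B by rewrite mem_nth.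
have b'B : nth 0%N B b' \in B by rewrite mem_nth.
have N0 : (0 < N)%N by rewrite expn_gt0 l_gt0.
have Nb : (nth 0%N B b < N ^ 2)%N.
  by rewrite -expnM mulnC; exact: digit_set_lt HR _ _ bB.
have Nb' : (nth 0%N B b' < N ^ 2)%N.
  by rewrite -expnM mulnC; exact: digit_set_lt HR _ _ b'B.
(* Once divided by [theta ^+ (2 * (s * D))], [c - c'] is killed by [h], since [c] and [c'] lie in
   [K]. *)
have Hz : (du ^+ 2 + e * dv ^+ 2 + j * N%:Z * du + (i0 * N%:Z ^+ 2 - db))%:~R
    = 0 :> F.
  rewrite -h_form -Ey.
  transitivity (h (theta ^- (2 * (s * D)) *
    secant_form D T (j * N%:Z) (i0 * N%:Z ^+ 2 - db))).
    by rewrite ET secant_form_top mulKf // expf_neq0.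
  by rewrite EE mulrBr raddfB (Kh cK c'K) subrr.
have uN := ltn_ord u; have u'N := ltn_ord u'.
have vN := leq_trans (ltn_ord v) VN; have v'N := leq_trans (ltn_ord v') VN.
have duN : `|du| < N%:Z by exact: normz_sub_lt.
have dvN : `|dv| < N%:Z by exact: normz_sub_lt.
have {}Hz := intr_eq0_small _ Hz.
have {}Hz : du ^+ 2 + e * dv ^+ 2 + j * N%:Z * du + N%:Z ^+ 2 * i0
    = (nth 0%N B b)%:Z - (nth 0%N B b')%:Z.
  suff zp : `|du ^+ 2 + e * dv ^+ 2 + j * N%:Z * du
      + (i0 * N%:Z ^+ 2 - db)| < p%:Z.
    by apply/eqP; rewrite -subr_eq0 -(Hz zp) /db; apply/eqP; ring.
  apply: (secant_bound e01 duN dvN _ _ (ltn_ord i) (ltn_ord i1) (ltn_ord i2) kp).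
    by move: Nb; rewrite -mulnn.
  by move: Nb'; rewrite -mulnn.
have e0v : e = 0 -> dv = 0.
  move=> /eV V1; have := ltn_ord v; have := ltn_ord v'; rewrite /dv.
  by move: (nat_of_ord v) (nat_of_ord v') => [|?] [|?]; rewrite V1.
have [du0 dv0 Eb] := digit_set_separated l_gt0 HR bB b'B duN dvN e0v Hz.
(* With [du], [dv] and the digit difference zero only [N^2 i0 = 0] is left; then the whole secant
   form, equal to [c - c'], vanishes. *)
have i00 : i0 = 0.
  move: Hz; rewrite du0 dv0 Eb subrr expr0n /= !mulr0 !add0r => /eqP.
  by rewrite mulf_eq0 expf_eq0 /= => /orP[|/eqP //]; lia.
have Ec : c = c'.
  apply/eqP; rewrite -subr_eq0 -EE ET Ey du0 dv0 i00 /db Eb subrr.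
  by rewrite !mul0r addr0 mulr0 /secant_form subrr expr0n /= !mulr0 !mul0r !addr0.
have Eb' : b = b'.
  apply: val_inj; apply/eqP.
  have := nth_uniq 0%N (ltn_ord b) (ltn_ord b') (uniq_digit_set l_gt0 HR H).
  by rewrite Eb eqxx => <-.
have Eu : u = u' by apply: val_inj; move: du0; rewrite /du /=; lia.
have Ev : v = v' by apply: val_inj; move: dv0; rewrite /dv /=; lia.
have Em : ms = ms'.
  by apply: val_inj => /=; apply: (inj_map val_inj).
by subst; congr (_, _, _); apply: val_inj.
Qed.

End Index.

(** Fixing [D] values of [g] and one of [h] costs [p ^ D.+1] in the constants, while the tower
    coefficients contribute [p ^ (2 * D)]; the net gain is [p ^ D / p]. *)
Lemma tower_local_arcs :
  exists2 S : {set {set pg_point F}}, uniform_local_arc k S &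
    (p ^ (m + D) * (N * V * (size R * l) ^ H) <= p * #|S|)%N.
Proof.
pose f t z := if (t < D)%N then g (theta ^- (2 * s * t) * z)
              else h (theta ^- (2 * (s * D)) * z).
have [t|K HK cK] := @large_common_fibre F F p D.+1 f.
  rewrite /f; case: (t < D)%N; [apply: (leq_trans _ gp) | apply: (leq_trans _ hp)];
    apply: subset_leq_card; apply/subsetP => y /imsetP[x _ ->]; exact: imset_f.
have N0 : (0 < N)%N by rewrite expn_gt0 l_gt0.
have kN : (k < p)%N && (N < p)%N.
  move: kp N0; rewrite -!mulnn; move: N => n; clear; nia.
have [kltp Nltp] := andP kN.
(* [N] and the nonzero differences of indices below [k] are smaller than [p], hence nonzero in
   [F]. *)
have w_inj (i j : 'I_k) : N%:R * theta ^+ (s * D) *+ i =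
    N%:R * theta ^+ (s * D) *+ j -> i = j.
  wlog ij : i j / (i <= j)%N.
    by move=> W; case: (leqP i j) => [/W //|/ltnW /W E /esym /E].
  move=> /eqP; rewrite eq_sym -subr_eq0 -mulrnBr // -[_ *+ (j - i)]mulr_natr !mulf_eq0.
  rewrite expf_eq0 (negPf theta_neq0) andbF orbF -!(dvdn_pcharf pF).
  rewrite (gtnNdvd N0 Nltp) /=; have [/eqP ji _|ji] := posnP (j - i).
    by apply: val_inj; apply/eqP; rewrite eqn_leq ij -subn_eq0.
  by rewrite gtnNdvd // (leq_ltn_trans (leq_subr i j)) // (ltn_trans _ kltp).
have [|S HS cS] := @parabola_local_arc F k (N%:R * theta ^+ (s * D)) w_inj
  (arc_index K) (@arc_x K) (@arc_a K) _ k_gt0.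
  move=> z t zt i i1 i2; apply: contraNneq zt => E; apply/eqP.
  apply: (arc_separated _ _ E).
    by move=> n nD x y xK yK; have := HK n (ltnW nD) x y xK yK; rewrite /f nD.
  by move=> x y xK yK; have := HK D (ltnSn D) x y xK yK; rewrite /f ltnn.
exists S => //; rewrite cS card_arc_index.
have := leq_mul (leqnn (p ^ D * (N * V * (size R * l) ^ H))%N) cK.
rewrite cardF expnS -expnM mul2n -addnn !expnD.
move: (p ^ D)%N (p ^ m)%N (N * V)%N N V ((size R * l) ^ H)%N #|K| => ? ? ? ? ? ? ?.
by nia.
Qed.

End Tower.

(** * Coordinates with respect to a primitive element *)

Definition additive_of (U V : zmodType) (f : U -> V)
    (fB : GRing.zmod_morphism f) : {additive U -> V} :=
  HB.pack f (GRing.isZmodMorphism.Build U V f fB).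

Lemma exists_primitive_element (F : finFieldType) :
  exists theta : F, (#|F|.-1).-primitive_root theta.
Proof.
have F1 : (1 < #|F|)%N := finNzRing_gt1 F.
have F0 : (0 < #|F|.-1)%N by rewrite -subn1 subn_gt0.
pose rs := enum (predC1 (0 : F)).
have szr : size rs = #|F|.-1 by rewrite -cardE cardC1.
have : has (#|F|.-1).-primitive_root rs.
  apply: has_prim_root; rewrite ?szr ?enum_uniq //.
  apply/allP => x; rewrite mem_enum inE => x0; rewrite unity_rootE.
  by rewrite -(inj_eq (mulIf x0)) mul1r -exprSr prednK ?expf_card // ltnW.
by case/hasP => x _ xP; exists x.
Qed.

(** * Powers of the Frobenius map as ring endomorphisms *)

Section Frobenius.

Variables (F : finFieldType) (p d : nat).
Hypothesis pF : p \in [pchar F].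

Let pnatQ : [pchar F].-nat (p ^ d)%N.
Proof.
rewrite (eq_pnat _ (pcharf_eq pF)) pnatX pnat_id ?orbT //.
by case/andP: pF.
Qed.

Definition frob (x : F) := x ^+ (p ^ d).

Lemma frob_zmod_morphism : GRing.zmod_morphism frob.
Proof.
by move=> x y; rewrite /frob exprDn_pchar // exprNn_pchar.
Qed.

Lemma frob_monoid_morphism : GRing.monoid_morphism frob.
Proof. by split=> [|x y]; rewrite /frob ?expr1n ?exprMn. Qed.

Definition frobenius : {rmorphism F -> F} :=
  HB.pack frob (GRing.isZmodMorphism.Build F F frob frob_zmod_morphism)
    (GRing.isMonoidMorphism.Build F F frob frob_monoid_morphism).

Lemma frobeniusE x : frobenius x = x ^+ (p ^ d).
Proof. by []. Qed.

End Frobenius.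

Section Coordinates.

Variables (F : finFieldType) (p d n : nat).
Hypotheses (pF : p \in [pchar F]) (d_gt0 : (0 < d)%N) (n_gt1 : (1 < n)%N).
Local Notation Q := (p ^ d)%N.
Hypothesis cardF : #|F| = (Q ^ n)%N.
Variable theta : F.
Hypothesis theta_prim : (#|F|.-1).-primitive_root theta.

Local Notation fr := (frobenius d pF).

(** The subfield with [Q] elements, kept inside [F]; polynomials over it are then the members of
    [{poly F}] fixed by Frobenius. *)
Definition subfield_set : {set F} := [set x | x ^+ Q == x].
Local Notation E := subfield_set.

Lemma subfieldP x : reflect (fr x = x) (x \in E).
Proof. by rewrite inE; apply: eqP. Qed.

Lemma Q_gt1 : (1 < Q)%N.
Proof.
have p1 : (1 < p)%N by apply: prime_gt1; case/andP: pF.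
by rewrite -(exp1n d) ltn_exp2r.
Qed.

Lemma theta_neq0 : theta != 0.
Proof.
apply/eqP => t0; have := prim_expr_order theta_prim; rewrite t0 expr0n.
have := finNzRing_gt1 F; case: #|F|.-1 (prim_order_gt0 theta_prim) => //= ? _ _.
by move/eqP; rewrite eq_sym oner_eq0.
Qed.

Lemma theta_expr_inj i j : (i < #|F|.-1)%N -> (j < #|F|.-1)%N ->
  theta ^+ i = theta ^+ j -> i = j.
Proof.
move=> iF jF /eqP; rewrite (eq_prim_root_expr theta_prim).
by rewrite !modn_small // => /eqP.
Qed.

Definition conjugates : seq F := [seq theta ^+ (Q ^ i) | i <- iota 0 n].

(** The exponents satisfy [Q^i <= Q^(n-1) < Q^n - 1], the last number being the order of [theta]. *)
Lemma uniq_conjugates : uniq conjugates.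
Proof.
rewrite map_inj_in_uniq ?iota_uniq // => i j; rewrite !mem_iota /= !add0n.
move=> i_n j_n /theta_expr_inj E.
have lt k : (k < n)%N -> (Q ^ k < #|F|.-1)%N.
  move=> kn; rewrite cardF; have Q1 := Q_gt1.
  case: n n_gt1 kn => // n' n'0 kn.
  have := leq_pexp2l (ltnW Q1) (kn : (k <= n')%N).
  have : (Q ^ 1 <= Q ^ n')%N by rewrite leq_pexp2l // ltnW.
  by rewrite expn1 expnS; move: (Q ^ k)%N (Q ^ n')%N => a b; nia.
by have /eqP := E (lt i i_n) (lt j j_n); rewrite eqn_exp2l ?Q_gt1 // => /eqP.
Qed.

Definition over_subfield (P : {poly F}) : Prop := map_poly fr P = P.

Lemma over_subfieldP P : over_subfield P <-> forall i, P`_i \in E.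
Proof.
split=> [H i|H]; first by apply/subfieldP; rewrite -[in RHS]H coef_map.
by apply/polyP => i; rewrite coef_map; apply/subfieldP.
Qed.

Lemma over_subfieldD P R : over_subfield P -> over_subfield R ->
  over_subfield (P + R).
Proof. by rewrite /over_subfield rmorphD /= => -> ->. Qed.

Lemma over_subfieldB P R : over_subfield P -> over_subfield R ->
  over_subfield (P - R).
Proof. by rewrite /over_subfield rmorphB /= => -> ->. Qed.

Lemma over_subfieldM P R : over_subfield P -> over_subfield R ->
  over_subfield (P * R).
Proof. by rewrite /over_subfield rmorphM /= => -> ->. Qed.

Lemma over_subfieldC c : c \in E -> over_subfield c%:P.
Proof. by move=> /subfieldP; rewrite /over_subfield map_polyC /= => ->. Qed.

Lemma over_subfieldXn i : over_subfield 'X^i.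
Proof. by rewrite /over_subfield map_polyXn. Qed.

Lemma root_conjugates P : over_subfield P -> P.[theta] = 0 ->
  all (root P) conjugates.
Proof.
move=> PE P0; apply/allP => _ /mapP[i _ ->].
elim: i => [|i /rootP IH]; first by rewrite expn0 expr1; apply/rootP.
apply/rootP; rewrite expnSr exprM -frobeniusE.
rewrite -{1}PE horner_map IH; exact: rmorph0.
Qed.

(** A nonzero polynomial over the subfield vanishing at [theta] would have the [n] distinct
    conjugates as roots. *)
Lemma over_subfield_eq0 P : over_subfield P -> (size P <= n)%N ->
  P.[theta] = 0 -> P = 0.
Proof.
move=> PE sP P0; apply: contraTeq sP => Pn0; rewrite -ltnNge.
have := max_poly_roots Pn0 (root_conjugates PE P0) uniq_conjugates.
by rewrite size_map size_iota.
Qed.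

(** The exponent of the norm to the subfield. *)
Local Notation r := (\sum_(i < n) Q ^ i)%N.

(** At most [Q] elements as roots of ['X^Q - 'X]; at least [Q] as 0 and the [Q - 1] powers of
    [theta ^+ r]. *)
Lemma card_subfield : #|E| = Q.
Proof.
have Q1 := Q_gt1; apply/eqP; rewrite eqn_leq; apply/andP; split.
  pose P : {poly F} := 'X^Q - 'X.
  have sP : size P = Q.+1.
    by rewrite size_polyDl size_polyXn // size_polyN size_polyX.
  have P0 : P != 0 by rewrite -size_poly_gt0 sP.
  have := max_poly_roots P0 _ (enum_uniq E); rewrite sP -cardE ltnS; apply.
  apply/allP => x; rewrite mem_enum inE => /eqP xE.
  by rewrite rootE /P !hornerE xE subrr.
pose f (t : 'I_Q.-1) := theta ^+ (r * t).
have Qr : (#|F|.-1 = Q.-1 * r)%N by rewrite cardF predn_exp.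
have r0 : (0 < r)%N.
  by have := prim_order_gt0 theta_prim; rewrite Qr muln_gt0 => /andP[].
have f_inj : injective f.
  move=> i j; have ltr (k : 'I_Q.-1) : (r * k < #|F|.-1)%N.
    by rewrite Qr mulnC ltn_mul2r r0 ltn_ord.
  move=> /(theta_expr_inj (ltr i) (ltr j)) /eqP.
  by rewrite eqn_pmul2l // => /eqP; apply: val_inj.
have fE t : f t \in E.
  rewrite inE /f -exprM.
  have -> : (r * t * Q = r * t + #|F|.-1 * t)%N.
    rewrite Qr; move: (nat_of_ord t) (ltnW Q1) => b Q0.
    by rewrite -{2}(prednK Q0) mulnS [(_.-1 * r)%N]mulnC mulnAC.
  by rewrite exprD [theta ^+ (_.-1 * t)]exprM (prim_expr_order theta_prim) expr1n mulr1.
have f0 t : f t != 0 by rewrite expf_neq0 // theta_neq0.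
have sub : 0 |: f @: setT \subset E.
  apply/subsetP => x; rewrite in_setU1 => /orP[/eqP->|/imsetP[t _ ->] //].
  by rewrite inE expr0n; move: Q1; case: Q.
apply: leq_trans (subset_leq_card sub).
rewrite cardsU1 card_imset // cardsT card_ord.
have -> : 0 \notin f @: setT.
  by apply/imsetP => -[t _ E0]; have := f0 t; rewrite -E0 eqxx.
by rewrite add1n prednK // ltnW.
Qed.

Definition poly_of_coords (c : {ffun 'I_n -> F}) : {poly F} :=
  \sum_(i < n) c i *: 'X^i.

Lemma coef_poly_of_coords (c : {ffun 'I_n -> F}) (i : 'I_n) :
  (poly_of_coords c)`_i = c i.
Proof.
rewrite coef_sum (bigD1 i) //= coefZ coefXn eqxx mulr1 big1 ?addr0 // => j ji.
rewrite coefZ coefXn; case: eqP => [/val_inj E|]; last by rewrite mulr0.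
by rewrite E eqxx in ji.
Qed.

Lemma size_poly_of_coords c : (size (poly_of_coords c) <= n)%N.
Proof.
apply/leq_sizeP => j nj; rewrite coef_sum big1 // => i _.
rewrite coefZ coefXn; case: eqP => [E|]; last by rewrite mulr0.
by have := ltn_ord i; rewrite -E ltnNge nj.
Qed.

Lemma over_poly_of_coords (c : {ffun 'I_n -> F}) : (forall i, c i \in E) ->
  over_subfield (poly_of_coords c).
Proof.
move=> cE; apply/over_subfieldP => i; case: (ltnP i n) => [i_n|ni].
  by rewrite (coef_poly_of_coords c (Ordinal i_n)).
rewrite nth_default ?(leq_trans (size_poly_of_coords c)) //.
by apply/subfieldP; rewrite rmorph0.
Qed.

(** Evaluation at [theta] is injective on the [Q ^ n] coordinate vectors, hence bijective by
    counting. *)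
Lemma exists_poly z : exists P : {poly F},
  [/\ over_subfield P, (size P <= n)%N & P.[theta] = z].
Proof.
pose T := {x : F | x \in E}.
pose c (f : {ffun 'I_n -> T}) : {ffun 'I_n -> F} := [ffun i => val (f i)].
have cE f i : c f i \in E by rewrite ffunE; case: (f i).
pose ev f := (poly_of_coords (c f)).[theta].
have ev_inj : injective ev.
  move=> f f' /eqP; rewrite -subr_eq0 -hornerN -hornerD => /eqP E0.
  have P0 := over_subfield_eq0 (over_subfieldB (over_poly_of_coords (cE f))
    (over_poly_of_coords (cE f'))) _ E0.
  have /eqP : poly_of_coords (c f) - poly_of_coords (c f') = 0.
    apply: P0; apply: leq_trans (size_polyD _ _) _.
    by rewrite size_polyN geq_max !size_poly_of_coords.
  rewrite subr_eq0 => /eqP H; apply/ffunP => i; apply: val_inj.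
  have := congr1 (fun P : {poly F} => P`_i) H.
  by rewrite /= !coef_poly_of_coords !ffunE.
have [g _ gK] : bijective ev.
  apply: inj_card_bij => //.
  by rewrite card_ffun card_ord card_sig card_subfield cardF.
exists (poly_of_coords (c (g z))); split; last exact: gK.
  exact: over_poly_of_coords.
exact: size_poly_of_coords.
Qed.

Lemma exists_coord_poly z : exists P : {poly F},
  [&& map_poly fr P == P, (size P <= n)%N & P.[theta] == z].
Proof.
by have [P [H1 H2 H3]] := exists_poly z; exists P; rewrite H1 H2 H3 !eqxx.
Qed.

Definition coord_poly z : {poly F} := xchoose (exists_coord_poly z).
Definition theta_coord j z : F := (coord_poly z)`_j.

Lemma coord_polyP z : [/\ over_subfield (coord_poly z),
  (size (coord_poly z) <= n)%N & (coord_poly z).[theta] = z].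
Proof. by have /and3P[/eqP ? ? /eqP ?] := xchooseP (exists_coord_poly z). Qed.

Lemma coord_horner P j : over_subfield P -> (size P <= n)%N ->
  theta_coord j P.[theta] = P`_j.
Proof.
move=> PE sP; have [H1 H2 H3] := coord_polyP P.[theta].
suff /eqP : coord_poly P.[theta] - P = 0.
  by rewrite /theta_coord subr_eq0 => /eqP ->.
apply: over_subfield_eq0; first exact: over_subfieldB.
  by apply: leq_trans (size_polyD _ _) _; rewrite size_polyN geq_max H2.
by rewrite hornerD hornerN H3 subrr.
Qed.

Lemma coord_subfield j z : theta_coord j z \in E.
Proof. by have [/over_subfieldP H _ _] := coord_polyP z; exact: H. Qed.

Lemma coord_zmod_morphism j : GRing.zmod_morphism (theta_coord j).
Proof.
move=> x y; have [x1 x2 x3] := coord_polyP x; have [y1 y2 y3] := coord_polyP y.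
rewrite -{1}x3 -{1}y3 -hornerN -hornerD coord_horner ?coefB //.
  exact: over_subfieldB.
by apply: leq_trans (size_polyD _ _) _; rewrite size_polyN geq_max x2.
Qed.

(* The two top coefficients are reduced by means of [theta ^+ n]. *)
Lemma coord0_wrap P : over_subfield P -> (size P <= n.+2)%N ->
  theta_coord 0 P.[theta] = P`_0 + theta_coord 0 (theta ^+ n) *
    (P`_n + P`_n.+1 * theta_coord n.-1 (theta ^+ n)).
Proof.
move=> PE sP; have n0 : (0 < n)%N by exact: ltnW.
rewrite /theta_coord; have := coord_polyP (theta ^+ n).
set C := coord_poly (theta ^+ n) => -[C1 C2 C3].
rewrite -/(theta_coord 0 _).
(* ['X * C] represents [theta ^+ n.+1] but has degree up to [n], so its coefficient at ['X^n] is
   replaced by a multiple of [C]. *)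
pose R : {poly F} := take_poly n P + (P`_n)%:P * C
  + (P`_n.+1)%:P * ('X * C - (C`_n.-1)%:P * 'X^n + (C`_n.-1)%:P * C).
have coefXC i : ('X * C)`_i.+1 = C`_i by rewrite coefXM.
have PR : P.[theta] = R.[theta].
  have -> : P = take_poly n P + (P`_n)%:P * 'X^n + (P`_n.+1)%:P * 'X^(n.+1).
    apply/polyP => i; rewrite !coefD coef_take_poly !coefCM !coefXn.
    case: ltngtP => [i_n|n_i|->].
    - by rewrite ltn_eqF ?ltnS 1?ltnW // !mulr0 !addr0.
    - have [->|ni] := eqVneq i n.+1; first by rewrite mulr0 mulr1 !add0r.
      rewrite !mulr0 !addr0 nth_default //; apply: leq_trans sP _.
      by rewrite ltn_neqAle eq_sym ni.
    - by rewrite ltn_eqF // !mulr0 mulr1 addr0 add0r.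
  by rewrite /R !hornerE C3 exprS; ring.
have RE : over_subfield R.
  have PiE i : over_subfield (P`_i)%:P.
    exact/over_subfieldC/(iffLR (over_subfieldP P)).
  have CiE i : over_subfield (C`_i)%:P.
    exact/over_subfieldC/(iffLR (over_subfieldP C)).
  apply: over_subfieldD; last first.
    apply: over_subfieldM => //; apply: over_subfieldD.
      apply: over_subfieldB; apply: over_subfieldM => //.
        exact: (over_subfieldXn 1).
      exact: over_subfieldXn.
    exact: over_subfieldM.
  apply: over_subfieldD; last exact: over_subfieldM.
  apply/over_subfieldP => i; rewrite coef_take_poly; case: ifP => _.
    exact: (iffLR (over_subfieldP P)).
  by apply/subfieldP; rewrite rmorph0.
have sR : (size R <= n)%N.
  apply/leq_sizeP => i ni; rewrite !(coefD, coefN, coefCM).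
  rewrite coef_take_poly ltnNge ni /= add0r coefXn.
  have Ci : C`_i = 0 by rewrite nth_default // (leq_trans C2).
  rewrite Ci !mulr0 add0r addr0.
  case: i ni Ci => [|i] ni Ci; first by move: ni; rewrite leqn0 gtn_eqF.
  rewrite coefXC; have [Ei|Ni] := eqVneq i.+1 n.
    by rewrite -Ei /= mulr1 subrr mulr0.
  have ni' : (n <= i)%N by move: ni; rewrite leq_eqVlt eq_sym (negPf Ni).
  have -> : C`_i = 0 by rewrite nth_default // (leq_trans C2).
  by rewrite mulr0 subrr mulr0.
rewrite PR coord_horner // !(coefD, coefN, coefCM) coefXM /=.
by rewrite coef_take_poly n0 coefXn (ltn_eqF n0) /=; ring.
Qed.

(** ['X^n - C] is monic with the conjugates as roots; its value at 0 is, up to sign, their product,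
    the norm of [theta]. *)
Lemma coord0_theta_n : theta_coord 0 (theta ^+ n) = - (-1) ^+ n * theta ^+ r.
Proof.
have [C1 C2 C3] := coord_polyP (theta ^+ n).
set C := coord_poly _ in C1 C2 C3.
pose G := 'X^n - C.
have sG : size G = n.+1.
  by rewrite size_polyDl size_polyXn // size_polyN ltnS.
have GE : over_subfield G by apply: over_subfieldB => //; exact: over_subfieldXn.
have G0 : G.[theta] = 0 by rewrite /G !hornerE C3 subrr.
have sz : size conjugates = n by rewrite size_map size_iota.
have := all_roots_prod_XsubC (p := G) (rs := conjugates).
rewrite sG sz uniq_rootsE => /(_ erefl (root_conjugates GE G0) uniq_conjugates).
have -> : lead_coef G = 1.
  rewrite lead_coefE sG /= coefB coefXn eqxx nth_default ?subr0 //.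
rewrite scale1r => /(congr1 (fun P : {poly F} => P.[0])).
rewrite /G hornerD hornerN hornerXn expr0n gtn_eqF ?(ltnW n_gt1) // add0r.
rewrite [C.[0]]horner_coef0 horner_prod => /(congr1 -%R); rewrite opprK => E0.
have iotaE : iota 0 n = index_iota 0 n by rewrite /index_iota subn0.
rewrite -[LHS]/(C`_0) E0 /conjugates big_map iotaE big_mkord mulNr.
congr (- _); rewrite -prodrXr.
transitivity (\prod_(i < n) - theta ^+ (Q ^ i)).
  by apply: eq_bigr => i _; rewrite hornerXsubC sub0r.
by rewrite prodrN card_ord.
Qed.

(** Euler's criterion: the exponent [r * (Q - 1) / 2] is half the order of [theta]. *)
Lemma theta_norm_nonsquare : odd Q -> (theta ^+ r) ^+ (Q.-1)./2 != 1.
Proof.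
move=> oQ; rewrite -exprM.
have Qr : (#|F|.-1 = Q.-1 * r)%N by rewrite cardF predn_exp.
have F0 := prim_order_gt0 theta_prim.
have Q1 := Q_gt1.
have Qe : ((Q.-1)./2 * 2 = Q.-1)%N.
  by rewrite muln2 even_halfK // -oddS prednK // ltnW.
have E2 : (r * (Q.-1)./2 * 2 = #|F|.-1)%N by rewrite -mulnA Qe mulnC.
rewrite -(expr0 theta); apply/eqP => /theta_expr_inj E0.
move: F0 E2 E0; move: (r * _)%N #|F|.-1 => a b b0 ab E0.
by have := E0 _ b0; lia.
Qed.

End Coordinates.

(** * Odd degree *)

(** The values of [f] are roots of ['X^q - c 'X]. The case [c = 1] covers maps into [F_p], and
    [c = -1] the skew map used in even degree. *)
Lemma card_frobenius_eigen (F : finFieldType) (q : nat) (c : F) (f : F -> F) :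
  (1 < q)%N -> (forall z, f z ^+ q = c * f z) -> (#|f @: F| <= q)%N.
Proof.
move=> q1 fq; pose P : {poly F} := 'X^q - c *: 'X.
have sP : size P = q.+1.
  rewrite size_polyDl size_polyXn // size_polyN.
  by apply: leq_ltn_trans (size_scale_leq _ _) _; rewrite size_polyX.
have P0 : P != 0 by rewrite -size_poly_gt0 sP.
have := max_poly_roots P0 _ (enum_uniq (f @: F)); rewrite sP -cardE ltnS; apply.
apply/allP => x; rewrite mem_enum => /imsetP[z _ ->].
by rewrite rootE /P !hornerE fq subrr.
Qed.

(** * Degree bounds and closure properties over the subfield *)

Section DegreeBounds.

Variables (F : finFieldType) (p d : nat).
Hypothesis pF : p \in [pchar F].

Definition deg_over (P : {poly F}) (k : nat) : Prop :=
  over_subfield d pF P /\ (size P <= k.+1)%N.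

Lemma deg_overS P k k' : deg_over P k -> (k <= k')%N -> deg_over P k'.
Proof. by move=> [H1 H2] kk; split=> //; apply: leq_trans H2 _. Qed.

Lemma deg_overD P R k : deg_over P k -> deg_over R k -> deg_over (P + R) k.
Proof.
move=> [H1 H2] [H3 H4]; split; first exact: over_subfieldD.
by apply: leq_trans (size_polyD _ _) _; rewrite geq_max H2.
Qed.

Lemma deg_overM P R k k' : deg_over P k -> deg_over R k' ->
  deg_over (P * R) (k + k').
Proof.
move=> [H1 H2] [H3 H4]; split; first exact: over_subfieldM.
apply: leq_trans (size_polyMleq _ _) _.
rewrite -subn1 leq_subLR; apply: leq_trans (leq_add H2 H4) _.
by rewrite addSn addnS add1n.
Qed.

Lemma deg_overC c : c \in subfield_set F p d -> deg_over c%:P 0.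
Proof.
move=> cE; split; first exact: over_subfieldC.
by rewrite size_polyC leq_b1.
Qed.

Lemma deg_overXn k : deg_over 'X^k k.
Proof. by split; [exact: over_subfieldXn | rewrite size_polyXn]. Qed.

Lemma deg_overX : deg_over 'X 1.
Proof. exact: (deg_overXn 1). Qed.

Lemma subfield_int (u : int) : u%:~R \in subfield_set F p d.
Proof. by apply/(subfieldP d pF); rewrite rmorph_int. Qed.

Lemma subfield0 : 0 \in subfield_set F p d.
Proof. exact: (subfield_int 0). Qed.

Lemma subfieldD x y : x \in subfield_set F p d -> y \in subfield_set F p d ->
  x + y \in subfield_set F p d.
Proof.
by move=> /(subfieldP d pF) xE /(subfieldP d pF) yE;
  apply/(subfieldP d pF); rewrite rmorphD xE yE.
Qed.

Lemma subfieldN x : x \in subfield_set F p d -> - x \in subfield_set F p d.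
Proof.
by move=> /(subfieldP d pF) xE; apply/(subfieldP d pF); rewrite rmorphN xE.
Qed.

Lemma subfieldM x y : x \in subfield_set F p d -> y \in subfield_set F p d ->
  x * y \in subfield_set F p d.
Proof.
by move=> /(subfieldP d pF) xE /(subfieldP d pF) yE;
  apply/(subfieldP d pF); rewrite rmorphM xE yE.
Qed.

Lemma subfieldV x : x \in subfield_set F p d -> x^-1 \in subfield_set F p d.
Proof.
by move=> /(subfieldP d pF) xE; apply/(subfieldP d pF); rewrite fmorphV xE.
Qed.

Lemma subfield_expr1 x : x \in subfield_set F p d -> x != 0 ->
  x ^+ (p ^ d).-1 = 1.
Proof.
rewrite inE => /eqP xE x0; apply: (mulIf x0).
by rewrite mul1r -exprSr prednK // expn_gt0 prime_gt0 //; case/andP: pF.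
Qed.

End DegreeBounds.

Section OddDegree.

Variables (F : finFieldType) (p m k H : nat).
Hypotheses (p_odd : odd p) (pF : p \in [pchar F]) (cardF : #|F| = (p ^ m)%N).
Hypotheses (m_ge3 : (3 <= m)%N) (k_gt0 : (0 < k)%N).
Hypothesis kp : ((k + 2) ^ 2 * (3 ^ H) ^ 2 <= p)%N.

(** Tower with [s = 3], [beta = theta] and coefficients [u + v theta] over [F_p]. The height
    [D = (m - 3) %/ 6] keeps the degree of secant forms, at most [6 (D - 1) + 8], below [m], so
    nothing has to be reduced. *)
Lemma odd_degree_local_arcs :
  exists2 S : {set {set pg_point F}}, uniform_local_arc k S &
    (p ^ (m + (m - 3) %/ 6) * (3 ^ H * 3 ^ H * 3 ^ H) <= p * #|S|)%N.
Proof.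
have [theta theta_prim] := exists_primitive_element F.
have m_gt1 : (1 < m)%N by exact: ltnW.
have cF : #|F| = ((p ^ 1) ^ m)%N by rewrite expn1.
pose c := theta_coord pF (ltn0Sn 0) m_gt1 cF theta_prim.
have cB j : GRing.zmod_morphism (c j) by exact: coord_zmod_morphism.
have cH P j : deg_over 1 pF P m.-1 -> c j P.[theta] = P`_j.
  by case=> P1 P2; apply: coord_horner => //; rewrite prednK // in P2; lia.
have cE j z : c j z \in subfield_set F p 1 by exact: coord_subfield.
(* A nonsquare of [F_p], as the norm of a primitive element. *)
pose nu := theta ^+ (\sum_(i < m) (p ^ 1) ^ i)%N.
have nuE : nu \in subfield_set F p 1.
  have := cE 0%N (theta ^+ m); rewrite /c coord0_theta_n -/nu => nuE.
  have -> : nu = - (-1) ^+ m * (- (-1) ^+ m * nu).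
    by rewrite mulrA mulrNN -exprD addnn -mul2n exprM sqrrN expr1n expr1n mul1r.
  apply: subfieldM => //; apply: subfieldN => //.
  by have := subfield_int 1 pF ((-1) ^+ m); rewrite rmorphXn rmorphN1.
(* Raising [x^2 = nu y^2] to the power [(p - 1) / 2] would give [nu] the power 1, against its being
   a nonsquare. *)
have nuN x y : x \in subfield_set F p 1 -> y \in subfield_set F p 1 ->
    x ^+ 2 - nu * y ^+ 2 = 0 -> x = 0 /\ y = 0.
  move=> xE yE /eqP; rewrite subr_eq0 => /eqP E.
  have [y0|y0] := eqVneq y 0.
    by move/eqP: E; rewrite y0 expr0n mulr0 expf_eq0 /= => /eqP.
  have x0 : x != 0.
    apply: contraTneq isT => x0; move/eqP: E; rewrite x0 expr0n eq_sym mulf_eq0.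
    rewrite (negPf (expf_neq0 _ y0)) orbF expf_eq0.
    by rewrite (negPf (theta_neq0 theta_prim)) andbF.
  have oQ : odd (p ^ 1) by rewrite expn1.
  have /eqP := theta_norm_nonsquare pF (ltn0Sn 0) m_gt1 cF theta_prim oQ.
  case; rewrite -/nu; have pe : (2 * (p ^ 1).-1./2 = (p ^ 1).-1)%N.
    rewrite mul2n even_halfK // -oddS prednK // expn1; exact: odd_gt0.
  have := congr1 (fun z => z ^+ (p ^ 1).-1./2) E.
  rewrite /= [(nu * _) ^+ _]exprMn -[x ^+ 2 ^+ _]exprM -[y ^+ 2 ^+ _]exprM !pe.
  rewrite !(subfield_expr1 pF) //.
  by rewrite mulr1.
(* On [(u + v theta)^2] this gives [u^2 - nu v^2], while [hf] below gives [u^2 + v^2]. *)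
pose gf z := c 0%N z - nu * c 2 z.
have gB : GRing.zmod_morphism gf by move=> x y; rewrite /gf !cB; ring.
pose hf z := c 0%N z + c 2 z.
have hB : GRing.zmod_morphism hf by move=> x y; rewrite /hf !cB; ring.
have fp f : (forall z, f z \in subfield_set F p 1) -> (#|f @: F| <= p)%N.
  move=> fE; apply: (@card_frobenius_eigen _ _ 1).
    by apply: prime_gt1; case/andP: pF.
  by move=> z; have := fE z; rewrite inE expn1 mul1r => /eqP.
pose M : {set F} := [set uv.1 + uv.2 * theta | uv in
  setX (subfield_set F p 1) (subfield_set F p 1)].
have MP a : a \in M -> exists u v, [/\ u \in subfield_set F p 1,
    v \in subfield_set F p 1 & a = (u%:P + v%:P * 'X).[theta]].
  move=> /imsetP[[u v] /setXP[uE vE] ->]; exists u, v; split=> //=.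
  by rewrite !hornerE.
have Mdeg u v : u \in subfield_set F p 1 -> v \in subfield_set F p 1 ->
    deg_over 1 pF (u%:P + v%:P * 'X) 1.
  move=> uE vE; apply: deg_overD; first exact: deg_overS (deg_overC pF uE) _.
  by apply: (@deg_overM _ _ _ _ _ _ 0 1); [exact: deg_overC | exact: deg_overX].
have MM u v : u \in subfield_set F p 1 -> v \in subfield_set F p 1 ->
    u + v * theta \in M.
  by move=> uE vE; apply/imsetP; exists (u, v) => //; apply/setXP.
have cardM : #|M| = (p ^ 2)%N.
  rewrite card_in_imset ?cardsX ?(card_subfield pF _ cF theta_prim) ?expn1 //.
  move=> [u v] [u' v'] /setXP[uE vE] /setXP[u'E v'E] /= E.
  have D1 : deg_over 1 pF (u%:P + v%:P * 'X) m.-1.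
    by apply: (deg_overS (Mdeg _ _ uE vE)); lia.
  have D2 : deg_over 1 pF (u'%:P + v'%:P * 'X) m.-1.
    by apply: (deg_overS (Mdeg _ _ u'E v'E)); lia.
  have EE : (u%:P + v%:P * 'X).[theta] = (u'%:P + v'%:P * 'X).[theta].
    by rewrite !hornerE.
  have := congr1 (c 0%N) EE; have := congr1 (c 1%N) EE; rewrite !cH //.
  by rewrite !coefD !coefC !coefCM !coefX /= !(mulr0, mulr1, addr0, add0r) => -> ->.
have lvl n y : level theta 3 M theta n y ->
    exists2 P, deg_over 1 pF P (3 * n + 1)%N & y = P.[theta].
  case=> ms [u [v [<- sM ->]]]; elim: ms sM => [|a ms IH] sM.
    exists ((u%:~R)%:P + (v%:~R)%:P * 'X); last by rewrite !hornerE.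
    by apply: Mdeg; exact: subfield_int.
  have [|P Pd PE] := IH; first by move=> x xs; apply: sM; rewrite inE xs orbT.
  have [|u1 [v1 [u1E v1E ->]]] := MP a; first by apply: sM; rewrite inE eqxx.
  exists (u1%:P + v1%:P * 'X + 'X^3 * P); last by rewrite /= PE !hornerE.
  apply: deg_overD; first by apply: (deg_overS (Mdeg _ _ u1E v1E)); lia.
  by apply: (deg_overS (deg_overM (deg_overXn _ pF 3) Pd)); rewrite /=; lia.
have mD : (6 * ((m - 3) %/ 6) + 3 <= m)%N by lia.
have Msub : {in M &, forall a b, a - b \in M}.
  move=> _ _ /imsetP[[u v] /setXP[uE vE] ->] /imsetP[[u' v'] /setXP[u'E v'E] ->].
  rewrite /= (_ : _ - _ = (u - u') + (v - v') * theta); last by ring.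
  by apply: MM; apply: subfieldD => //; apply: subfieldN.
have lead n a y j i : (n < (m - 3) %/ 6)%N -> a \in M ->
    level theta 3 M theta n y ->
    additive_of gB (secant_form theta 3 n.+1 (a + theta ^+ 3 * y) j i) = 0 ->
    a = 0.
  move=> nD /MP[u [v [uE vE ->]]] /lvl[P Pd ->].
  pose A := u%:P + v%:P * 'X.
  pose T := A + 'X^3 * P.
  pose W := T ^+ 2 + (j%:~R)%:P * T * 'X^(3 * n.+1)
    + (i%:~R)%:P * 'X^(2 * (3 * n.+1)).
  have Td : deg_over 1 pF T (3 * n + 4)%N.
    apply: deg_overD; first by apply: (deg_overS (Mdeg _ _ uE vE)); lia.
    by apply: (deg_overS (deg_overM (deg_overXn _ pF 3) Pd)); lia.
  have Wd : deg_over 1 pF W m.-1.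
    apply: (@deg_overS _ _ _ _ _ (6 * n + 8)); last by lia.
    apply: deg_overD; first apply: deg_overD.
    - by rewrite expr2; apply: (deg_overS (deg_overM Td Td)); lia.
    - apply: (deg_overS (deg_overM (deg_overM (deg_overC pF (subfield_int 1 pF j))
        Td) (deg_overXn _ pF _))); lia.
    - apply: (deg_overS (deg_overM (deg_overC pF (subfield_int 1 pF i))
        (deg_overXn _ pF _))); lia.
  have -> : secant_form theta 3 n.+1
      ((u%:P + v%:P * 'X).[theta] + theta ^+ 3 * P.[theta]) j i = W.[theta].
    by rewrite /secant_form /W /T /A !hornerE.
  (* Everything besides [A ^+ 2] is divisible by ['X^3] and does not reach positions 0 and 2. *)
  have WE : W = A ^+ 2 + 'X^3 * (2%:R * A * P + 'X^3 * P ^+ 2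
      + (j%:~R)%:P * T * 'X^(3 * n) + (i%:~R)%:P * 'X^(3 * n + (3 * n + 3))).
    by rewrite /W mul2n -addnn mulnS !exprD /T; ring.
  rewrite [LHS]/(gf _) /gf !cH // WE !coefD !coefXnM /= !addr0.
  have -> : A ^+ 2 = (u * u)%:P + (u * v + u * v)%:P * 'X + (v * v)%:P * 'X^2.
    by rewrite /A polyCD !polyCM; ring.
  rewrite !coefD !coefC !coefCM !coefX !coefXn /=.
  rewrite !(mulr0, mulr1, addr0, add0r) -!expr2 => /(nuN _ _ uE vE)[-> ->].
  by rewrite !hornerE.
have h1 : additive_of hB 1 = 1.
  have d1 : deg_over 1 pF 1%:P m.-1.
    exact: deg_overS (deg_overC pF (subfield_int 1 pF 1)) _.
  rewrite [LHS]/(hf _) /hf -[1 in LHS](hornerC _ theta) !cH //.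
  by rewrite !coefC /= addr0.
have dX j : (j < m)%N -> deg_over 1 pF 'X^j m.-1.
  by move=> jm; apply: (deg_overS (deg_overXn _ pF j)); lia.
have hb : additive_of hB theta = 0.
  have dX1 : deg_over 1 pF 'X m.-1 by exact: (dX 1%N).
  by rewrite [LHS]/(hf _) /hf -[theta in LHS]hornerX !cH // !coefX addr0.
have hb2 : additive_of hB (theta ^+ 2) = 1%:~R.
  rewrite [LHS]/(hf _) /hf -[theta ^+ 2 in LHS]hornerXn !cH //; try exact: dX.
  by rewrite !coefXn add0r.
have gp : (#|additive_of gB @: F| <= p)%N.
  apply: fp => z; apply: subfieldD => //; apply: subfieldN => //.
  exact: subfieldM.
have hp : (#|additive_of hB @: F| <= p)%N by apply: fp => z; apply: subfieldD.
have := @tower_local_arcs F p m pF cardF theta 3 M (additive_of gB)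
  (additive_of hB) theta 1 ((m - 3) %/ 6) (theta_neq0 theta_prim) Msub lead
  h1 hb hb2 3 [:: 0%N] H k (3 ^ H) isT residue_set3 (leqnn _) _ isT k_gt0 kp
  gp hp cardM.
by apply.
Qed.

End OddDegree.

(** * Even degree *)

Section HalfTrace.

Variables (F : finFieldType) (p : nat).
Hypotheses (p_odd : odd p) (pF : p \in [pchar F]).

(** On the field with [p ^ 2] elements this is half the trace to [F_p], normalised to fix 1. *)
Definition half_trace (x : F) := (x + x ^+ p) / 2%:R.

Lemma two_neq0 : 2%:R != 0 :> F.
Proof.
rewrite -(dvdn_pcharf pF) gtnNdvd //; move: p_odd pF.
by case: p => [|[|[|?]]] // _ /andP[].
Qed.

Lemma exprB_pchar (x y : F) : (x - y) ^+ p = x ^+ p - y ^+ p.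
Proof. by have := frob_zmod_morphism 1 pF x y; rewrite /frob expn1. Qed.

Lemma half_trace_zmod_morphism : GRing.zmod_morphism half_trace.
Proof. by move=> x y; rewrite /half_trace exprB_pchar; ring. Qed.

Lemma half_trace1 : half_trace 1 = 1.
Proof. by rewrite /half_trace expr1n -mulr2n divff // two_neq0. Qed.

Lemma half_trace_fixed x : x ^+ (p ^ 2) = x ->
  half_trace x ^+ p = half_trace x.
Proof.
move=> xE; rewrite /half_trace expr_div_n.
have -> : (x + x ^+ p) ^+ p = x ^+ p + x.
  by rewrite -{1}(opprK (x ^+ p)) exprB_pchar exprNn -signr_odd p_odd mulN1r
    opprK -exprM mulnn xE.
have -> : 2%:R ^+ p = 2%:R :> F.
  by have := rmorph_nat (frobenius 1 pF) 2; rewrite frobeniusE expn1.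
by rewrite addrC.
Qed.

End HalfTrace.

(** For Euler's criterion over [p ^ 2] elements: the exponent is a multiple of [p - 1], so nonzero
    elements of [F_p] are squares there, and it is even, so signs disappear. *)
Lemma half_pred_sqr p : odd p ->
  ((p ^ 2).-1./2 = p.-1 * p.+1./2)%N /\ ~~ odd (p.-1 * p.+1./2).
Proof.
move=> po; have := odd_double_half p; rewrite po; move: (p./2) => q <-.
have -> : (true + q.*2 = q.*2.+1)%N by [].
have -> : ((q.*2.+1) ^ 2).-1 = (q.*2 * q.+1).*2.
  by rewrite -mulnn -!mul2n; lia.
by rewrite doubleK /= doubleK oddM odd_double.
Qed.

(** Tower of height 0 with [beta = 0] and [e = 0]: the half trace of a square of an integer [u] is
    [u^2], and the digits modulo 205 avoid squares. *)
Lemma quadratic_local_arcs (F : finFieldType) (p k H : nat) :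
  odd p -> p \in [pchar F] -> #|F| = (p ^ 2)%N -> (0 < k)%N ->
  ((k + 2) ^ 2 * (205 ^ H) ^ 2 <= p)%N ->
  exists2 S : {set {set pg_point F}}, uniform_local_arc k S &
    (p ^ 2 * (205 ^ H * (12 * 205) ^ H) <= p * #|S|)%N.
Proof.
move=> p_odd pF cardF k_gt0 kp.
have hB := half_trace_zmod_morphism pF.
have fp : (#|additive_of hB @: F| <= p)%N.
  apply: (@card_frobenius_eigen _ _ 1).
    by apply: prime_gt1; case/andP: pF.
  move=> z; rewrite mul1r; apply: half_trace_fixed => //.
  by rewrite -cardF expf_card.
have h0 : additive_of hB 0 = 0 by rewrite raddf0.
have h00 : additive_of hB (0 ^+ 2) = 0%:~R by rewrite expr2 mul0r h0.
have N0 : (0 < 205 ^ H)%N by rewrite expn_gt0.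
have cM : #|[set: F]| = (p ^ 2)%N by rewrite cardsT.
have [|//|S HS] := @tower_local_arcs F p 2 pF cardF 1 0 [set: F]
  (additive_of hB) (additive_of hB) 0 0 0 (oner_neq0 F) _ _
  (half_trace1 p_odd pF) h0 h00 205 lewko_set H k 1 isT residue_set205 N0
  (fun=> erefl) isT k_gt0 kp fp fp cM.
  by move=> a b _ _; rewrite in_setT.
by rewrite muln1 addn0 => cS; exists S.
Qed.

Section EvenDegree.

Variables (F : finFieldType) (p n k H : nat).
Hypotheses (p_odd : odd p) (pF : p \in [pchar F]).
Hypothesis cardF : #|F| = (p ^ (2 * n))%N.
Hypotheses (n_ge3 : (3 <= n)%N) (k_gt0 : (0 < k)%N).
Hypothesis kp : ((k + 2) ^ 2 * (3 ^ H) ^ 2 <= p)%N.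

Local Notation D := (n.-1 %/ 2)%N.

(** Tower with [s = 1] and coefficients in the field with [p ^ 2] elements. Secant forms reach
    degree at most [2 D + 2 <= n + 1], so at most the two positions treated by [coord0_wrap]
    overflow. *)
Lemma even_degree_local_arcs :
  exists2 S : {set {set pg_point F}}, uniform_local_arc k S &
    (p ^ (2 * n + D) * (3 ^ H * 3 ^ H * 3 ^ H) <= p * #|S|)%N.
Proof.
have [theta theta_prim] := exists_primitive_element F.
have n_gt1 : (1 < n)%N by exact: ltnW.
have p_gt1 : (1 < p)%N by apply: prime_gt1; case/andP: pF.
have cF : #|F| = ((p ^ 2) ^ n)%N by rewrite -expnM.
pose c := theta_coord pF (ltn0Sn 1) n_gt1 cF theta_prim.
have cB j : GRing.zmod_morphism (c j) by exact: coord_zmod_morphism.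
have cH P j : deg_over 2 pF P n.-1 -> c j P.[theta] = P`_j.
  by case=> P1 P2; apply: coord_horner => //; rewrite prednK // in P2; lia.
have cE j z : c j z \in subfield_set F p 2 by exact: coord_subfield.
pose c0 := c 0%N (theta ^+ n).
pose c1 := c n.-1 (theta ^+ n).
have oQ : odd (p ^ 2) by rewrite oddX p_odd orbT.
have c0N : c0 ^+ (p ^ 2).-1./2 != 1.
  have := theta_norm_nonsquare pF (ltn0Sn 1) n_gt1 cF theta_prim oQ.
  rewrite /c0 /c coord0_theta_n exprMn.
  have -> : (- (-1) ^+ n) ^+ (p ^ 2).-1./2 = 1 :> F; last by rewrite mul1r.
  have [-> /negPf ev] := half_pred_sqr p_odd.
  by rewrite -mulN1r -exprS -exprM mulnC exprM -[_ ^+ (_ * _)]signr_odd ev expr0 expr1n.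
have c0_neq0 : c0 != 0.
  rewrite /c0 /c coord0_theta_n mulf_neq0 ?oppr_eq0 ?signr_eq0 //.
  by rewrite expf_neq0 // theta_neq0.
(* [phi] vanishes exactly on the [F_p]-multiples of [c0]. As [c0] is a nonsquare and nonzero
   elements of [F_p] are squares in the subfield, 0 is the only square there that [phi] kills. *)
pose phi z := z / c0 - (z / c0) ^+ p.
have phiB : GRing.zmod_morphism phi.
  by move=> x y; rewrite /phi mulrBl (exprB_pchar pF); ring.
have phi_sq a : a \in subfield_set F p 2 -> phi (a ^+ 2) = 0 -> a = 0.
  move=> aE /eqP; rewrite subr_eq0 => /eqP E; apply/eqP; apply: contraNT c0N => a0.
  set w := a ^+ 2 / c0 in E.
  have w0 : w != 0 by rewrite mulf_neq0 ?invr_eq0 ?expf_neq0.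
  have aw : a ^+ 2 = c0 * w by rewrite /w mulrC divfK.
  have wp : w ^+ p.-1 = 1.
    by apply: (mulIf w0); rewrite mul1r -exprSr prednK // ltnW.
  have pe : (2 * (p ^ 2).-1./2 = (p ^ 2).-1)%N.
    by rewrite mul2n even_halfK // -oddS prednK // expn_gt0 ltnW.
  have wh : w ^+ (p ^ 2).-1./2 = 1.
    by have [-> _] := half_pred_sqr p_odd; rewrite exprM wp expr1n.
  have := congr1 (fun z => z ^+ (p ^ 2).-1./2) aw.
  rewrite /= [(c0 * _) ^+ _]exprMn wh mulr1 -exprM pe => <-.
  by rewrite (subfield_expr1 pF).
have phi_c0 t : t ^+ p = t -> phi (c0 * t) = 0.
  by move=> tp; rewrite /phi mulrC mulKf // tp subrr.
pose gf z := phi (c 0%N z).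
have gB : GRing.zmod_morphism gf by move=> x y; rewrite /gf cB phiB.
(* The choice of [mu] makes the reduced terms of the secant form integer
   multiples of [c0] when [n = 2 D + 1]. *)
pose mu : F := if odd n then - c1 / 2%:R else 0.
have muE : mu \in subfield_set F p 2.
  rewrite /mu; case: ifP => _; last exact: subfield0.
  apply: subfieldM => //; first by apply: subfieldN => //; exact: cE.
  by apply: subfieldV => //; exact: (subfield_int 2 pF 2).
(* The weights give [1], [theta + mu] and [(theta + mu)^2] the values 1, 0 and 1. *)
pose hf z := half_trace p (c 0%N z - mu * c 1%N z + (1 + mu ^+ 2) * c 2 z).
have hB : GRing.zmod_morphism hf.
  move=> x y; rewrite /hf -(half_trace_zmod_morphism pF) !cB.
  by congr half_trace; ring.
have Mdeg u v : u \in subfield_set F p 2 -> v \in subfield_set F p 2 ->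
    deg_over 2 pF (u%:P + v%:P * 'X) 1.
  move=> uE vE; apply: deg_overD; first exact: deg_overS (deg_overC pF uE) _.
  by apply: (@deg_overM _ _ _ _ _ _ 0 1); [exact: deg_overC | exact: deg_overX].
pose M := subfield_set F p 2.
have cardM : #|M| = (p ^ 2)%N by exact: (card_subfield pF _ cF theta_prim).
(* The clause for [l = 0] is needed because [l.-1] is then 0 and would allow a constant. *)
have lvl l y : level theta 1 M (theta + mu) l y ->
    exists (P : {poly F}) (u v : int), [/\ (l = 0%N -> P = 0),
      deg_over 2 pF P l.-1 &
      y = (P + 'X^l * ((u%:~R + v%:~R * mu)%:P + (v%:~R)%:P * 'X)).[theta]].
  case=> ms [u [v [<- sM ->]]]; elim: ms sM => [|a ms IH] sM.
    exists 0, u, v; split=> //; first exact: deg_overC (subfield0 2 pF).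
    by rewrite !hornerE /=; ring.
  have [|P [u1 [v1 [P0 Pd PE]]]] := IH.
    by move=> x xs; apply: sM; rewrite inE xs orbT.
  have aE : a \in M by apply: sM; rewrite inE eqxx.
  exists (a%:P + 'X * P), u1, v1; split=> //=.
    apply: deg_overD; first exact: deg_overS (deg_overC pF aE) _.
    case: (size ms) P0 Pd => [/(_ erefl) -> _|l1 _ Pd].
      by rewrite mulr0; exact: deg_overC (subfield0 2 pF).
    exact: deg_overM (deg_overX _ pF) Pd.
  by rewrite PE !hornerE expr1 [theta ^+ _.+1]exprS; ring.
have Msub : {in M &, forall a b, a - b \in M}.
  by move=> a b aM bM; apply: subfieldD => //; apply: subfieldN.
have lead l a y j i : (l < D)%N -> a \in M ->
    level theta 1 M (theta + mu) l y ->
    additive_of gB (secant_form theta 1 l.+1 (a + theta ^+ 1 * y) j i) = 0 ->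
    a = 0.
  move=> lD aE /lvl[P [u [v [P0 Pd ->]]]].
  pose tau : F := u%:~R + v%:~R * mu.
  pose T1 : {poly F} := a%:P + 'X * P.
  have tauE : tau \in subfield_set F p 2.
    apply: subfieldD => //; first exact: subfield_int.
    by apply: subfieldM => //; exact: subfield_int.
  have T1d : deg_over 2 pF T1 l.
    apply: deg_overD; first exact: deg_overS (deg_overC pF aE) _.
    case: {lD} l P0 Pd => [/(_ erefl) -> _|l1 _ Pd].
      by rewrite mulr0; exact: deg_overC (subfield0 2 pF).
    exact: deg_overM (deg_overX _ pF) Pd.
  have intd (z : int) : deg_over 2 pF (z%:~R)%:P 0.
    exact: deg_overC (subfield_int 2 pF z).
  pose B : {poly F} := tau%:P + (v%:~R)%:P * 'X.
  have Bd : deg_over 2 pF B 1 by apply: Mdeg => //; exact: subfield_int.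
  have taud := deg_overC pF tauE.
  (* [L] gathers the terms of degree at most [2 l + 2 < n]; the two higher coefficients are made
     explicit in [W]. *)
  pose L : {poly F} := T1 * T1 + (2%:~R)%:P * (T1 * ('X^(l.+1) * B))
    + (j%:~R)%:P * (T1 * 'X^(l.+1))
    + (tau%:P * tau%:P + (j%:~R)%:P * tau%:P + (i%:~R)%:P) * 'X^(2 * l.+1).
  have Ld : deg_over 2 pF L (2 * l + 2).
    apply: deg_overD; first apply: deg_overD; first apply: deg_overD.
    - by apply: (deg_overS (deg_overM T1d T1d)); move: lD; clear; lia.
    - apply: (deg_overS (deg_overM (intd _)
        (deg_overM T1d (deg_overM (deg_overXn _ pF _) Bd)))); move: lD; clear; lia.
    - apply: (deg_overS (deg_overM (intd _)
        (deg_overM T1d (deg_overXn _ pF _)))); move: lD; clear; lia.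
    - have d0 : deg_over 2 pF
          (tau%:P * tau%:P + (j%:~R)%:P * tau%:P + (i%:~R)%:P) 0.
        apply: deg_overD => //; apply: deg_overD; first exact: (deg_overM taud taud).
        exact: (deg_overM (intd j) taud).
      by apply: (deg_overS (deg_overM d0 (deg_overXn _ pF _))); move: lD; clear; lia.
  pose wv : F := 2%:~R * tau * v%:~R + j%:~R * v%:~R.
  pose W : {poly F} := L + wv%:P * 'X^(2 * l + 3)
    + (v%:~R * v%:~R)%:P * 'X^(2 * l + 4).
  have wvE : wv \in subfield_set F p 2.
    have iE z := subfield_int 2 pF z.
    by apply: subfieldD => //; apply: subfieldM => //; apply: subfieldM.
  have vvE : (v%:~R * v%:~R : F) \in subfield_set F p 2.
    by apply: subfieldM => //; exact: subfield_int.
  have Wd : deg_over 2 pF W n.+1.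
    apply: (@deg_overS _ _ _ _ _ (2 * l + 4)); last by move: lD; clear; lia.
    apply: deg_overD; first apply: deg_overD.
    - by apply: (deg_overS Ld); move: lD; clear; lia.
    - apply: (deg_overS (deg_overM (deg_overC pF wvE) (deg_overXn _ pF _))).
      by move: lD; clear; lia.
    - apply: (deg_overS (deg_overM (deg_overC pF vvE) (deg_overXn _ pF _))).
      by move: lD; clear; lia.
  have -> : secant_form theta 1 l.+1 (a + theta ^+ 1 *
     (P + 'X^l * ((u%:~R + v%:~R * mu)%:P + (v%:~R)%:P * 'X)).[theta]) j i
     = W.[theta].
    rewrite /secant_form /W /L /T1 /B -/tau /wv !hornerE ?mul1n.
    by rewrite !mul2n -!addnn !exprD !exprS !expr0 /=; ring.
  rewrite [LHS]/(gf _) /gf.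
  have [W1 W2] := Wd.
  rewrite {1}/c coord0_wrap // -/c -/c0 -/c1.
  have W0 : W`_0 = a ^+ 2.
    rewrite -horner_coef0 /W /L /T1 /B !hornerE !expr0n /= !addn_eq0 /=.
    by rewrite !(mulr0, mul0r, addr0) !andbF !mulr0 !addr0 expr2.
  rewrite W0.
  have -> : phi (a ^+ 2 + c0 * (W`_n + W`_n.+1 * c1)) = phi (a ^+ 2).
    rewrite -{1}(opprK (c0 * _)) phiB -mulrN phi_c0 ?subr0 //.
    have Lc q : (2 * l + 2 < q)%N -> L`_q = 0.
      by move=> lq; case: Ld => _ sL; rewrite nth_default // (leq_trans sL).
    have intp (z : int) : (z%:~R : F) ^+ p = z%:~R.
      by have := rmorph_int (frobenius 1 pF) z; rewrite frobeniusE expn1.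
    suff [z ->] : exists z : int, W`_n + W`_n.+1 * c1 = z%:~R.
      by rewrite -mulrNz intp.
    have Wc q : (2 * l + 2 < q)%N -> W`_q = wv * (q == 2 * l + 3)%N%:R
        + v%:~R * v%:~R * (q == 2 * l + 4)%N%:R.
      by move=> lq; rewrite /W coefD coefD !coefCM !coefXn Lc // add0r.
    have ln : (2 * l + 2 < n)%N by move: lD; clear; lia.
    rewrite !Wc //; last exact: ltnW.
    (* Both top terms overflow if [n = 2 l + 3], where [2 mu + c1 = 0] leaves an integer; otherwise
       at most the integer [v^2] does. *)
    have [n3|n3] := boolP (n == 2 * l + 3)%N.
      move/eqP: n3 => n3; exists (2 * u * v + j * v).
      have on : odd n by rewrite n3 oddD oddM.
      rewrite (_ : (n == 2 * l + 4)%N = false); last by move: n3; clear; lia.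
      rewrite (_ : (n.+1 == 2 * l + 3)%N = false); last by move: n3; clear; lia.
      rewrite (_ : (n.+1 == 2 * l + 4)%N); last by move: n3; clear; lia.
      rewrite /wv /tau /mu on !(mulr0, mulr1, addr0, add0r).
      rewrite !(rmorphD, rmorphM) /=.
      have t0 := two_neq0 p_odd pF.
      by field.
    rewrite (_ : (n.+1 == 2 * l + 3)%N = false); last by move: ln; clear; lia.
    rewrite (_ : (n.+1 == 2 * l + 4)%N = false); last by move: n3; clear; lia.
    exists (v * v *+ (n == 2 * l + 4)%N).
    by rewrite rmorphMn rmorphM /= !(mulr0, add0r, addr0, mul0r) mulr_natr.
  exact: phi_sq.
have dX j : (j < n)%N -> deg_over 2 pF 'X^j n.-1.
  by move=> jn; apply: (deg_overS (deg_overXn _ pF j)); lia.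
have h1 : additive_of hB 1 = 1.
  have d1 : deg_over 2 pF 1%:P n.-1.
    exact: deg_overS (deg_overC pF (subfield_int 2 pF 1)) _.
  have cc j : c j 1 = (1%:P : {poly F})`_j by have := cH _ j d1; rewrite hornerC.
  rewrite [LHS]/(hf _) /hf !cc !coefC /=.
  by rewrite !mulr0 subr0 addr0 half_trace1.
have betad : deg_over 2 pF (mu%:P + 1%:P * 'X) 1.
  by apply: Mdeg => //; exact: (subfield_int 2 pF 1).
have betaE : theta + mu = (mu%:P + 1%:P * 'X).[theta].
  by rewrite !hornerE addrC.
have hb : additive_of hB (theta + mu) = 0.
  have d1 : deg_over 2 pF (mu%:P + 1%:P * 'X) n.-1.
    by apply: (deg_overS betad); lia.
  rewrite [LHS]/(hf _) /hf betaE !cH // !coefD !coefCM !coefC !coefX /=.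
  rewrite !(mulr0, mulr1, addr0, add0r, subrr) /half_trace expr0n.
  by rewrite gtn_eqF ?add0r ?mul0r // ltnW.
have hb2 : additive_of hB ((theta + mu) ^+ 2) = 1%:~R.
  have d1 : deg_over 2 pF ((mu%:P + 1%:P * 'X) * (mu%:P + 1%:P * 'X)) n.-1.
    by apply: (deg_overS (deg_overM betad betad)); lia.
  rewrite [LHS]/(hf _) /hf betaE expr2 -hornerM !cH //.
  have -> : (mu%:P + 1%:P * 'X) * (mu%:P + 1%:P * 'X) =
      (mu * mu)%:P + (mu + mu)%:P * 'X + 'X^2 :> {poly F}.
    by rewrite polyCD polyCM; ring.
  rewrite !coefD !coefCM !coefC !coefX !coefXn /=.
  rewrite (_ : _ - _ + _ = 1); last by ring.
  exact: half_trace1.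
have gp : (#|additive_of gB @: F| <= p)%N.
  apply: (@card_frobenius_eigen _ _ (-1)) => // z.
  rewrite [additive_of gB z]/(gf z) /gf /phi (exprB_pchar pF) -exprM mulnn.
  have : c 0%N z / c0 \in subfield_set F p 2.
    by apply: subfieldM => //; apply: subfieldV => //; exact: cE.
  by rewrite inE => /eqP ->; rewrite mulN1r opprB.
have hp : (#|additive_of hB @: F| <= p)%N.
  apply: (@card_frobenius_eigen _ _ 1) => // z; rewrite mul1r.
  apply: half_trace_fixed => //; apply/eqP.
  suff: c 0%N z - mu * c 1%N z + (1 + mu ^+ 2) * c 2 z \in subfield_set F p 2.
    by rewrite inE.
  apply: subfieldD => //; first apply: subfieldD => //.
    by apply: subfieldN => //; apply: subfieldM.
  apply: subfieldM => //; apply: subfieldD => //; first exact: (subfield_int 2 pF 1).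
  by rewrite expr2; apply: subfieldM.
have := @tower_local_arcs F p (2 * n) pF cardF theta 1 M (additive_of gB)
  (additive_of hB) (theta + mu) 1 D (theta_neq0 theta_prim) Msub lead
  h1 hb hb2 3 [:: 0%N] H k (3 ^ H) isT residue_set3 (leqnn _) _ isT k_gt0 kp
  gp hp cardM.
by apply.
Qed.

End EvenDegree.

(** * Asymptotics *)

(** Binary arithmetic makes the powers computable; the identity [B = A + (B - A)] with truncated
    subtraction expresses [A <= B]. *)
Lemma leq_exp_205_12 : (205 ^ 1167 <= 12 ^ 2500)%N.
Proof.
pose pow a b := BinNat.N.pow (BinNat.N.of_nat a) (BinNat.N.of_nat b).
have powE a b : (a ^ b)%N = BinNat.N.to_nat (pow a b).
  rewrite Nnat.N2Nat.inj_pow !Nnat.Nat2N.id; elim: b => // b IH.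
  by rewrite expnS IH.
pose A := pow 205%N 1167%N; pose B := pow 12%N 2500%N.
have BE : BinNat.N.eqb B (BinNat.N.add A (BinNat.N.sub B A)) by vm_compute.
rewrite !powE -/A -/B; move: A B BE => A B /BinNat.N.eqb_eq ->.
rewrite Nnat.N2Nat.inj_add plusE.
exact: leq_addr.
Qed.

Section Asymptotics.

Variable R : realType.

(** [H] is taken maximal with [C l^(2H) <= p], so [l^(2H)] is at least [p / (C l^2)] and
    [W^H >= (l^(2H))^tau] has order [p^tau]. *)
Lemma Omega_of_digits (m k a l W : nat) (tau e : R) :
  (1 < l)%N -> (0 < k)%N -> 0 <= tau -> l%:R `^ (2 * tau) <= W%:R ->
  m%:R * e <= a%:R - 1 + tau ->
  (forall (p H : nat) (F : finFieldType), prime p -> odd p ->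
    #|F| = (p ^ m)%N -> ((k + 2) ^ 2 * (l ^ H) ^ 2 <= p)%N ->
    exists2 S : {set {set pg_point F}}, uniform_local_arc k S &
      (p ^ a * W ^ H <= p * #|S|)%N) ->
  has_uniform_local_arcs_Omega m k e.
Proof.
move=> l1 k0 tau0 lW me arcs; pose C := ((k + 2) ^ 2)%N.
have C9 : (9 <= C)%N by rewrite /C -mulnn; nia.
have l2 : (1 < l ^ 2)%N by rewrite -mulnn; nia.
have K0 : 0 < (C * l ^ 2)%:R `^ tau :> R.
  by rewrite powR_gt0 // ltr0n muln_gt0 expn_gt0; lia.
exists ((C * l ^ 2)%:R `^ tau)^-1; first by rewrite invr_gt0.
(* [p >= C >= 9] makes [p] odd and [p %/ C] positive. *)
exists C => p p_pr Cp F cardF.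
have p_odd : odd p by case: (even_prime p_pr) => // p2; lia.
have pC : (0 < p %/ C)%N by rewrite divn_gt0 //; lia.
pose H := trunc_log (l ^ 2) (p %/ C).
have [|S HS cS] := arcs p H F p_pr p_odd cardF.
  rewrite -/C -expnM mulnC [(H * 2)%N]mulnC expnM -leq_divRL; last by lia.
  exact: trunc_logP.
exists S => //.
have p_gt0 : (0 < p)%N by exact: prime_gt0.
have pR0 : 0 < p%:R :> R by rewrite ltr0n.
have pH : p%:R `^ tau <= (C * l ^ 2)%:R `^ tau * (W ^ H)%:R :> R.
  have pl : (p <= C * l ^ 2 * (l ^ 2) ^ H)%N.
    have := trunc_log_ltn (p %/ C) l2; rewrite -/H ltn_divLR; last by lia.
    by rewrite expnS mulnC => /ltnW; rewrite -mulnA.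
  apply: (@le_trans _ _ ((C * l ^ 2)%:R `^ tau * ((l ^ 2) ^ H)%:R `^ tau)).
    rewrite -powRM ?ler0n // -natrM; apply: ge0_ler_powR; rewrite ?nnegrE ?ler0n //.
    by rewrite ler_nat.
  rewrite ler_pM2l // -expnM !natrX -(powR_mulrn (2 * H)) ?ler0n // -powRrM.
  rewrite natrM mulrAC powRrM powR_mulrn ?powR_ge0 //.
  by rewrite lerXn2r ?nnegrE ?powR_ge0 ?ler0n.
rewrite natrX -powR_mulrn ?ler0n // -powRrM.
rewrite ler_pdivrMl //; apply: (@le_trans _ _ (p%:R `^ (a%:R - 1 + tau))).
  by apply: ler_powR; rewrite ?ler1n.
have p0 : p%:R != 0 :> R by rewrite gt_eqF.
rewrite powRD; last by rewrite p0 implybT.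
rewrite powRD ?p0 ?implybT // powR_inv1 ?ler0n // powR_mulrn ?ler0n //.
apply: (@le_trans _ _ (p%:R ^+ a / p%:R * ((C * l ^ 2)%:R `^ tau * (W ^ H)%:R))).
  by rewrite ler_pM2l // divr_gt0 // exprn_gt0.
rewrite mulrCA ler_pM2l // mulrAC ler_pdivrMr // mulrC [X in _ <= X]mulrC.
by rewrite [X in X <= _]mulrC -natrX -!natrM ler_nat.
Qed.

Lemma powR_base3 : 3%:R `^ (2 * (3 / 2)) <= 27%:R :> R.
Proof.
have -> : 2 * (3 / 2) = 3%:R :> R by field.
by rewrite powR_mulrn ?ler0n // -natrX ler_nat.
Qed.

(** The exponent is [2 + 1167 / 2500], and the fractional part is compared after raising to the
    power 2500. *)
Lemma powR_base205 :
  205%:R `^ (2 * (12334 / 10000)) <= (205 * (12 * 205))%N%:R :> R.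
Proof.
have -> : 2 * (12334 / 10000) = 2%:R + 1167%:R / 2500%:R :> R by field.
rewrite powRD; last by rewrite pnatr_eq0 implybT.
rewrite powR_mulrn ?ler0n // expr2 mulnCA [(12 * _)%N]mulnC natrM natrM.
rewrite ler_pM2l; last by rewrite -natrM ltr0n.
have : (205%:R `^ (1167%:R / 2500%:R)) ^+ 2500 <= 12%:R ^+ 2500 :> R.
  rewrite -powR_mulrn ?powR_ge0 // -powRrM divfK ?pnatr_eq0 //.
  by rewrite powR_mulrn ?ler0n // -!natrX ler_nat leq_exp_205_12.
by rewrite ler_pXn2r ?nnegrE ?powR_ge0 ?ler0n.
Qed.

End Asymptotics.

Theorem theorem3p7 (R : realType) (m k : nat) (hm : (1 < m)%N) (hk : (1 <= k)%N) :
  [/\ odd m ->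
        has_uniform_local_arcs_Omega m k
          (11167 / 10000 - 3833 / 10000 / m%:R : R),
      m = 2%N ->
        has_uniform_local_arcs_Omega m k (11167 / 10000 : R),
      (2 %| m)%N -> ~~ (4 %| m)%N -> (2 < m)%N ->
        has_uniform_local_arcs_Omega m k
          (125 / 100 - 166 / 10000 / m%:R : R)
    & (4 %| m)%N -> (4 < m)%N ->
        has_uniform_local_arcs_Omega m k
          (125 / 100 - 7666 / 10000 / m%:R : R)].
Proof.
have m0 : m%:R != 0 :> R by rewrite pnatr_eq0 -lt0n ltnW.
have mE (x y : R) : m%:R * (x - y / m%:R) = m%:R * x - y by field.
have tau0 : 0 <= 3 / 2 :> R by lra.
have tau1 : 0 <= 12334 / 10000 :> R by lra.
have even D : (2 %| m)%N -> (4 < m)%N -> D = ((m %/ 2).-1 %/ 2)%N ->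
    forall e : R, m%:R * e <= (m + D)%:R - 1 + 3 / 2 ->
    has_uniform_local_arcs_Omega m k e.
  move=> m2 m3 DE e me.
  apply: (@Omega_of_digits R m k (m + D) 3 27 (3 / 2)) => //.
    exact: powR_base3.
  move=> p H F p_pr p_odd cardF kp.
  have mn : m = (2 * (m %/ 2))%N by rewrite mulnC divnK.
  have n3 : (3 <= m %/ 2)%N by move: m2 m3; clear; lia.
  have cF : #|F| = (p ^ (2 * (m %/ 2)))%N by rewrite -mn.
  have [S HS] := @even_degree_local_arcs F p (m %/ 2) k H p_odd
    (card_finPcharP cardF p_pr) cF n3 hk kp.
  by rewrite -mn -DE -!expnMn => cS; exists S.
split.
- move=> om; apply: (@Omega_of_digits R m k (m + (m - 3) %/ 6) 3 27 (3 / 2)) => //.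
  + exact: powR_base3.
  + rewrite mE natrD.
    (* With [D] the quotient, [0.1167 (6 D + 7) = 0.7002 D + 0.8169] is below [D + 0.5 + 0.3833]. *)
    have : (m <= 6 * ((m - 3) %/ 6) + 7)%N by move: om; clear; lia.
    rewrite -(ler_nat R) natrD natrM.
    have : 0 <= ((m - 3) %/ 6)%:R :> R by rewrite ler0n.
    by lra.
  + move=> p H F p_pr p_odd cardF kp.
    have [|S HS] := @odd_degree_local_arcs F p m k H p_odd
      (card_finPcharP cardF p_pr) cardF _ hk kp.
      by move: om hm; clear; lia.
    by rewrite -!expnMn => cS; exists S.
- move=> m2; apply: (@Omega_of_digits R m k 2 205 (205 * (12 * 205))
    (12334 / 10000) _ isT hk tau1 (powR_base205 R)).
  + by rewrite m2; lra.
  + move=> p H F p_pr p_odd cardF kp; rewrite m2 in cardF.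
    have [S HS] := @quadratic_local_arcs F p k H p_odd
      (card_finPcharP cardF p_pr) cardF hk kp.
    by rewrite -expnMn => cS; exists S.
- move=> m2 m4 m3; have m5 : (4 < m)%N by move: m2 m4 m3; clear; lia.
  apply: (even _ m2 m5 erefl); rewrite mE natrD.
  (* Here [m / 4 = D + 1/2], so [1.25 m] equals [m + D - 1 + 3/2]. *)
  have : (m = 4 * ((m %/ 2).-1 %/ 2) + 2)%N by move: m2 m4 m3; clear; lia.
  by move=> /(congr1 (fun i : nat => i%:R : R)); rewrite natrD natrM => E; lra.
- move=> m4 m5; apply: (even _ _ _ erefl); [|exact: m5|rewrite mE natrD].
    exact: dvdn_trans m4.
  (* Here [m / 4 = D + 1], so [1.25 m] exceeds [m + D - 1 + 3/2] by [1/2], less than [0.7666]. *)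
  have : (m = 4 * ((m %/ 2).-1 %/ 2) + 4)%N by move: m4 m5; clear; lia.
  by move=> /(congr1 (fun i : nat => i%:R : R)); rewrite natrD natrM => E; lra.
Qed.
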